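(* Assume that (i) the $\mathbb{P}$-essential infimum of $V$ is $0$ and the $\mathbb{P}$-essential supremum of $V$ is $1$, and (ii) for every $h\in(0,1)$ and $\ell\in\mathbb{N}$, $\mathbb{P}(V(T_y\omega)\le h \text{ for all } y\in\{0,\ldots,\ell\})>0$ and $\mathbb{P}(V(T_y\omega)\ge h \text{ for all } y\in\{0,\ldots,\ell\})>0$. Let $\delta\in(0,1)$, $c=\frac12\log\left(\frac{1+\delta}{1-\delta}\right)$, $0<\beta<\log\cosh(c)$ and $\theta\in\mathbb{R}$. Then for $\mathbb{P}$-a.e. $\omega$ the limit $$u_o(t,x\,|\,\delta,\beta,\theta)=\lim_{\epsilon\to0}\epsilon\, u([\epsilon^{-1}t],[\epsilon^{-1}x],\omega\,|\,\delta,\beta,\theta)$$ exists for every $t>0$ and $x\in\mathbb{R}$. Moreover, $u_o(t,x\,|\,\delta,\beta,\theta)=t\,\overline H_{\delta,\beta}(\theta)+\theta x$ with $\overline H_{\delta,\beta}(\theta):=u_o(1,0\,|\,\delta,\beta,\theta)$ deterministic, there exists a unique $\bar\theta(\beta,c)\in(0,c)$ such that $$\Lambda_\beta(\bar\theta(\beta,c)-c)=\log\cosh(c),$$ and the effective Hamiltonian is given by $$\overline H_{\delta,\beta}(\theta)=\begin{cases}0&\text{if }|\theta|<|\bar\theta(\beta,c)|,\\ \Lambda_\beta(|\theta|-c)-\log\cosh(c)&\text{if }|\theta|\ge|\bar\theta(\beta,c)|.\end{cases}$$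
   Context: $(\Omega,\mathcal{F},\mathbb{P})$ is a probability space equipped with an ergodic invertible measure-preserving transformation $T:\Omega\to\Omega$; $T_0=I$, $T_k=T\circ T_{k-1}$ and $T_{-k}=(T_k)^{-1}$ for $k\in\mathbb{N}=\{1,2,\ldots\}$. $V:\Omega\to[0,1]$ is a nonconstant measurable function. $[\cdot]$ denotes the floor function. For $n\in\mathbb{N}$ and $\delta\in[0,1]$, $\mathcal{P}_n(\delta)$ is the set of all $\pi=(\pi_0,\ldots,\pi_{n-1})$ where each $\pi_i=\pi_i(n,\omega,y,\pm1)\in[0,1]^2$ is $\mathcal{F}$-measurable in $\omega$ and satisfies $\pi_i(n,\omega,y,-1)+\pi_i(n,\omega,y,1)=1$ and $|\pi_i(n,\omega,y,1)-\pi_i(n,\omega,y,-1)|\le\delta$ for every $i\in\{0,\ldots,n-1\}$, $\omega\in\Omega$, $y\in\mathbb{Z}$. Given $\omega\in\Omega$ and $x\in\mathbb{Z}$, $\pi$ induces the probability measure $P_x^{\pi,\omega}$ (expectation $E_x^{\pi,\omega}$) on paths $(x_0,\ldots,x_n)\in\mathbb{Z}^{n+1}$ with $x_0=x$ and $z_{i+1}=x_{i+1}-x_i\in\{-1,1\}$ by $P_x^{\pi,\omega}(X_0=x_0,\ldots,X_n=x_n)=\prod_{i=0}^{n-1}\pi_i(n,\omega,x_i,z_{i+1})$. Define $$u(n,x,\omega\,|\,\delta,\beta,\theta)=\inf_{\pi\in\mathcal{P}_n(\delta)}\log E_x^{\pi,\omega}\left[e^{\beta\sum_{i=0}^{n-1}V(T_{X_i}\omega)+\theta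 X_n}\right].$$ The tilted free energy is $\Lambda_\beta(\theta)=\lim_{n\to\infty}\frac1n\log E_0\left[e^{\beta\sum_{i=0}^{n-1}V(T_{X_i}\omega)+\theta X_n}\right]$, where $E_0$ is expectation for simple symmetric random walk on $\mathbb{Z}$ started at $0$; under assumptions (i)-(ii) this limit exists for $\mathbb{P}$-a.e. $\omega$ and is deterministic, for every $\beta>0$ and $\theta\in\mathbb{R}$. *)

(* Defs.v *)
From HB Require Import structures.
From mathcomp Require Import all_boot all_order all_algebra.
From mathcomp Require Import all_classical all_reals all_analysis.

Import Order.TTheory GRing.Theory Num.Theory.
Import numFieldNormedType.Exports.

Local Open Scope classical_set_scope.
Local Open Scope ring_scope.

Definition cosh {R : realType} (c : R) : R := (expR c + expR (- c)) / 2.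

(* T_k; Ti stands for the inverse of T, see invertible_mpt. *)
Definition Tpow {Omega : Type} (T Ti : Omega -> Omega) (k : int) : Omega -> Omega :=
  match k with
  | Posz n => iter n T
  | Negz n => iter n.+1 Ti
  end.

Definition invertible_mpt {d : measure_display} {Omega : measurableType d}
    {R : realType} (P : probability Omega R) (T Ti : Omega -> Omega) : Prop :=
  [/\ cancel T Ti, cancel Ti T, measurable_fun setT T, measurable_fun setT Ti
    & forall A, measurable A -> P (T @^-1` A) = P A].

Definition ergodic {d : measure_display} {Omega : measurableType d}
    {R : realType} (P : probability Omega R) (T : Omega -> Omega) : Prop :=
  forall A, measurable A -> T @^-1` A = A -> P A = 0%E \/ P A = 1%E.

(* true encodes the step +1 and false the step -1. *)
Definition step (z : bool) : int := if z then 1 else - 1.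

(* Position x_i (i <= n) of the path started at x with steps z_1, ..., z_n.
   Step z_{j+1} is stored at index j. *)
Definition walk {n : nat} (x : int) (z : {ffun 'I_n -> bool}) (i : nat) : int :=
  x + \sum_(j < n | (j < i)%N) step (z j).

Definition path_prob {R : realType} {n : nat} (p : 'I_n -> int -> bool -> R)
    (x : int) (z : {ffun 'I_n -> bool}) : R :=
  \prod_(i < n) p i (walk x z i) (z i).

Definition path_expect {R : realType} {n : nat} (p : 'I_n -> int -> bool -> R)
    (x : int) (F : (nat -> int) -> R) : R :=
  \sum_(z : {ffun 'I_n -> bool}) path_prob p x z * F (walk x z).

Definition srw {R : realType} {n : nat} : 'I_n -> int -> bool -> R :=
  fun _ _ _ => 2^-1.

Definition exp_cost {Omega : Type} {R : realType} (T Ti : Omega -> Omega)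
    (V : Omega -> R) (beta theta : R) (n : nat) (w : Omega) (X : nat -> int) : R :=
  expR (beta * \sum_(i < n) V (Tpow T Ti (X i) w) + theta * (X n)%:~R).

Definition policy {d : measure_display} {Omega : measurableType d} {R : realType}
    (n : nat) (delta : R) : set ('I_n -> Omega -> int -> bool -> R) :=
  [set pi : 'I_n -> Omega -> int -> bool -> R |
     [/\ forall i y z, measurable_fun setT (fun w => pi i w y z),
         forall i w y z, 0 <= pi i w y z <= 1,
         forall i w y, pi i w y false + pi i w y true = 1
       & forall i w y, `|pi i w y true - pi i w y false| <= delta]].

(* For 0 <= delta the infimum is over a nonempty set of reals that is bounded
   below, since exp_cost is bounded away from 0 on the finitely many paths. *)
Definition u {d : measure_display} {Omega : measurableType d} {R : realType}
    (T Ti : Omega -> Omega) (V : Omega -> R) (delta beta theta : R)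
    (n : nat) (x : int) (w : Omega) : R :=
  inf [set ln (path_expect (fun i => pi i w) x
                 (exp_cost T Ti V beta theta n w))
      | pi in policy (Omega := Omega) n delta].

(* For eps, t > 0 the floor of t / eps is nonnegative, so Num.truncn is the
   floor as a natural number. *)
Definition scaled_u {d : measure_display} {Omega : measurableType d} {R : realType}
    (T Ti : Omega -> Omega) (V : Omega -> R) (delta beta theta : R)
    (w : Omega) (t x eps : R) : R :=
  eps * u T Ti V delta beta theta
          (Num.truncn (eps^-1 * t)) (Num.floor (eps^-1 * x)) w.

(* Meaningful only when the limit exists. *)
Definition u_o {d : measure_display} {Omega : measurableType d} {R : realType}
    (T Ti : Omega -> Omega) (V : Omega -> R) (delta beta theta : R)
    (w : Omega) (t x : R) : R :=
  lim (scaled_u T Ti V delta beta theta w t x eps @[eps --> 0^'+]).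

(* The deterministic almost sure limit; it is unique if it exists, as P is a
   probability, and get returns an unspecified real otherwise. *)
Definition tilted_free_energy {d : measure_display} {Omega : measurableType d}
    {R : realType} (P : probability Omega R) (T Ti : Omega -> Omega)
    (V : Omega -> R) (beta theta : R) : R :=
  get [set l : R | {ae P, forall w,
    n%:R^-1 * ln (path_expect (n := n) srw 0
                    (exp_cost T Ti V beta theta n w)) @[n --> \oo] --> l}].

(* Main.v *)
(* For a fixed environment the infimum over policies satisfies a dynamic programming
   equation, so functions G on the integers with
     exp(beta V(y)) min_q (q G(y+1) + (1-q) G(y-1)) >= exp(mu) G(y)  (resp. <=)
   and G(y) = exp(theta y + o(|y|)) bound the growth rate from below (resp. from above).

   The building blocks are the positive solutions of
   exp(beta V(y)) (f(y+1) + f(y-1)) / 2 = exp(lam) f(y) for lam > beta.  Their ratios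
   are stationary continued fractions of the environment, so by Birkhoff's theorem the
   decaying solution has a deterministic rate gam(lam), and by the Wronskian the growing
   solution has the opposite rate.  Hence Lambda_beta(theta) = lam when
   gam(lam) = |theta|, and Lambda_beta(theta) = beta, realized by staying on high hills,
   when gam > |theta| everywhere.

   Multiplying by exp(c y) turns a solution with eigenvalue exp(lam) into one for the
   walk with extreme drift to the left, with eigenvalue exp(lam) / cosh c; the drift is
   optimal as long as the product is increasing, that is for lam <= log cosh c or for
   growing solutions.  This gives the value for |theta| >= c - gam(log cosh c).  For
   smaller |theta| the controller traps the walk in a valley of V, which costs nothing,
   and lowering beta provides matching subsolutions. *)
Require Import Defs.
From HB Require Import structures.
From mathcomp Require Import all_boot all_order all_algebra.
From mathcomp Require Import all_classical all_reals all_analysis.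
From mathcomp Require Import ess_sup_inf measurable_realfun.
From mathcomp Require Import zify ring lra.

Import Order.TTheory GRing.Theory Num.Theory.
Import numFieldNormedType.Exports.

Local Open Scope classical_set_scope.
Local Open Scope ring_scope.

(** * One-sided Birkhoff bounds *)

(** The starting point [[x / eps]] moves with [eps], so one environment has to serve all starting
    points at once: a test function may depend on the starting point, its constants may not, and an
    error [eta * |x|] is affordable. This freedom lets a hill or a valley be chosen near each start,
    at a distance sublinear in [|x|]. Randomness enters in two ways, both through Birkhoff's
    theorem: as linear growth of the logarithms of solutions and as sublinear gaps between hills and
    between valleys. For [delta = 0] the only control is the fair coin, so the same sub- and
    supersolutions compute the tilted free energy, and its convexity or continuity is never invoked.
    In their place stand four facts: the rate [gam] is monotone in [lam], it is Lipschitz in [beta]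
    and [lam] away from [lam = beta], it is at least [lam - beta], and limits are unique, which
    makes it injective in [lam]. *)

Section birkhoff.
Context {d : measure_display} {Omega : measurableType d} {R : realType}.
Variables (P : probability Omega R) (T : Omega -> Omega).
Hypothesis mT : measurable_fun setT T.
Hypothesis PT : forall A, measurable A -> P (T @^-1` A) = P A.

Lemma bounded_integrable (f : Omega -> R) (B : R) :
  measurable_fun setT f -> (forall w, `|f w| <= B) ->
  P.-integrable setT (EFin \o f).
Proof.
move=> mf fB; apply: measurable_bounded_integrable => //.
  exact: le_lt_trans (probability_le1 P measurableT) (ltry _).
exists B; split; first exact: num_real.
by move=> x Bx w _; exact: le_trans (fB w) (ltW Bx).
Qed.

Lemma Rintegral_invariant (f : Omega -> R) (B : R) :
  measurable_fun setT f -> (forall w, `|f w| <= B) ->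
  \int[P]_w f (T w) = \int[P]_w f w.
Proof.
move=> mf fB; rewrite /Rintegral; congr fine.
transitivity (\int[pushforward P T]_w (f w)%:E)%E.
  rewrite integral_pushforward //; first exact/measurable_EFinP.
  apply: (bounded_integrable (f \o T) B) => [|w]; last exact: fB.
  exact: measurableT_comp.
by apply: eq_measure_integral => A mA _; exact: PT.
Qed.

(* The maximum of 0 and of the Birkhoff sums of [g] of length at most [n]. *)
Fixpoint max_sum (g : Omega -> R) (n : nat) (w : Omega) : R :=
  if n is m.+1 then Num.max 0 (g w + max_sum g m (T w)) else 0.

Implicit Types (g : Omega -> R) (B C : R) (n : nat) (w : Omega).

Lemma measurable_max_sum g n : measurable_fun setT g ->
  measurable_fun setT (max_sum g n).
Proof.
move=> mg; elim: n => [|n IH] /=; first exact: measurable_cst.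
apply: measurable_maxr; first exact: measurable_cst.
by apply: measurable_funD => //; apply: measurableT_comp.
Qed.

Lemma max_sum_ge0 g n w : 0 <= max_sum g n w.
Proof. by case: n => [|n] //=; rewrite le_max lexx. Qed.

Lemma max_sum_homo g w : {homo max_sum g ^~ w : m n / (m <= n)%N >-> m <= n}.
Proof.
apply: homo_leq => [x|x y z|n]; [exact: lexx|exact: le_trans|].
elim: n w => [|n IH] w; first exact: max_sum_ge0.
rewrite /= ge_max le_max lexx /= le_max; apply/orP; right.
by rewrite lerD2l IH.
Qed.

Lemma max_sum_le g B n w : (forall w, `|g w| <= B) -> max_sum g n w <= n%:R * B.
Proof.
move=> gB; elim: n w => [|n IH] w /=; first by rewrite mul0r.
have B0 : 0 <= B by apply: le_trans (gB w).
rewrite ge_max; apply/andP; split; first by rewrite mulr_ge0.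
have := IH (T w); have := ler_norm (g w); have := gB w.
by rewrite -natr1; lra.
Qed.

Lemma birkhoff_sum_le_max_sum g n w : \sum_(i < n) g (iter i T w) <= max_sum g n w.
Proof.
elim: n w => [|n IH] w /=; first by rewrite big_ord0.
rewrite big_ord_recl /= le_max; apply/orP; right; rewrite lerD2l.
apply: le_trans (IH (T w)); apply: ler_sum => i _.
by rewrite -iterSr /= add0n.
Qed.

(** The integrand equals [max_sum g n.+1 w - max_sum g n (T w)]. By invariance of the measure, its
    integral is that of [max_sum g n.+1 - max_sum g n], and maximal sums increase with [n]. *)
Lemma Rintegral_max_sum_ge0 g B n : measurable_fun setT g ->
  (forall w, `|g w| <= B) ->
  0 <= \int[P]_w Num.max (- max_sum g n (T w)) (g w).
Proof.
move=> mg gB.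
have mM k := measurable_max_sum g k mg.
have MB k w : `|max_sum g k w| <= k%:R * B.
  by rewrite ger0_norm ?max_sum_ge0 ?max_sum_le.
have MTB w : `|max_sum g n (T w)| <= n%:R * B by [].
have mMT : measurable_fun setT (fun w => max_sum g n (T w)).
  exact: (measurableT_comp (mM n)).
have -> : \int[P]_w Num.max (- max_sum g n (T w)) (g w)
    = \int[P]_w (max_sum g n.+1 w - max_sum g n (T w)).
  apply: eq_Rintegral => w _ /=.
  by rewrite [in RHS]addr_maxl sub0r addrK.
rewrite RintegralB //; last 2 first.
- exact: (bounded_integrable _ (n.+1%:R * B)).
- exact: (bounded_integrable _ (n%:R * B)).
rewrite (Rintegral_invariant (max_sum g n) (n%:R * B)) // subr_ge0.
apply: le_Rintegral => //.
- exact: (bounded_integrable _ (n%:R * B)).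
- exact: (bounded_integrable _ (n.+1%:R * B)).
- by move=> w _; exact: max_sum_homo.
Qed.

Definition unbounded_max_sum g : set Omega :=
  \bigcap_k \bigcup_n [set w | k%:R < max_sum g n w].

Lemma measurable_unbounded_max_sum g : measurable_fun setT g ->
  measurable (unbounded_max_sum g).
Proof.
move=> mg; apply: bigcap_measurable => // k _; apply: bigcup_measurable => n _.
rewrite -[X in measurable X]setTI.
have := measurable_max_sum g n mg measurableT `]k%:R, +oo[%classic.
rewrite (_ : _ @^-1` _ = [set w | k%:R < max_sum g n w]); first exact.
by apply/seteqP; split => w; rewrite /= in_itv /= andbT.
Qed.

Lemma unbounded_max_sumE g w : unbounded_max_sum g w <->
  forall C, exists n, C < max_sum g n w.
Proof.
split => [H C|H k _]; last by have [n Hn] := H k%:R; exists n.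
have [n _ /= Hn] := H (Num.truncn `|C|).+1 I; exists n.
apply: lt_trans Hn; apply: le_lt_trans (ler_norm C) _.
exact: truncnS_gt.
Qed.

(** Passing from [w] to [T w] changes the maximal sums by at most [B], up to a shift of [n] and the
    truncation at [0]. The invariance is exact and not only almost sure, as [ergodic] asks. *)
Lemma unbounded_max_sum_invariant g B : (forall w, `|g w| <= B) ->
  T @^-1` unbounded_max_sum g = unbounded_max_sum g.
Proof.
move=> gB; apply/seteqP; split => w /=.
  move=> /unbounded_max_sumE H; apply/unbounded_max_sumE => C.
  have [n Hn] := H (C + B); exists n.+1 => /=.
  rewrite lt_max; apply/orP; right.
  by have := gB w; rewrite ler_norml => /andP[? _]; lra.
move=> /unbounded_max_sumE H; apply/unbounded_max_sumE => C.
have [[|n] /=] := H (Num.max 0 (C + B)); first by rewrite gt_max ltxx.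
rewrite lt_max !gt_max ltxx /= => /andP[_ Hn]; exists n.
by have := gB w; rewrite ler_norml => /andP[_ ?]; lra.
Qed.

Hypothesis ergT : ergodic P T.

(* If the maximal sums were almost surely unbounded, then the integrand of
   [Rintegral_max_sum_ge0] would converge to [g], which would have a nonnegative integral. *)
Lemma ae_bounded_max_sum g B : measurable_fun setT g ->
  (forall w, `|g w| <= B) -> \int[P]_w g w < 0 ->
  {ae P, forall w, exists C, forall n, max_sum g n w <= C}.
Proof.
move=> mg gB; have mE := measurable_unbounded_max_sum g mg.
suff PE0 : \int[P]_w g w < 0 -> P (unbounded_max_sum g) = 0%E.
  move=> /PE0 PE; exists (unbounded_max_sum g); split => //.
  move=> w /= H; apply/unbounded_max_sumE => C.
  apply: contra_notP H => /forallNP H; exists C => n.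
  by rewrite leNgt; apply/negP.
move=> intg; have [//|PE1] := ergT _ mE (unbounded_max_sum_invariant g B gB).
have mM k := measurable_max_sum g k mg.
have mh n : measurable_fun setT (fun w => Num.max (- max_sum g n (T w)) (g w)).
  apply: measurable_maxr => //; apply: measurableT_comp => //.
  exact: (measurableT_comp (mM n)).
have hB n w : `|Num.max (- max_sum g n (T w)) (g w)| <= B.
  have := gB w; have := max_sum_ge0 g n (T w).
  rewrite !ler_norml le_max ge_max => ? /andP[Hl Hr].
  by rewrite Hl Hr orbT andbT /=; lra.
have aeE : {ae P, forall w, unbounded_max_sum g w}.
  exists (~` unbounded_max_sum g); split => //.
    exact: measurableC.
  by rewrite [LHS]probability_setC // PE1 subee.
have [||||_ _] := @dominated_convergence _ _ _ P setT measurableT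
  (fun n w => (Num.max (- max_sum g n (T w)) (g w))%:E)
  (EFin \o g) (cst B%:E) (fun n => (measurable_EFinP _ _).2 (mh n)).
- exact/measurable_EFinP.
- apply: filterS aeE => w Ew _; apply: cvg_near_cst.
  have : unbounded_max_sum g (T w).
    by move: Ew; rewrite -{1}(unbounded_max_sum_invariant g B gB).
  move=> /unbounded_max_sumE /(_ B) [N HN].
  exists N => // n /= Nn; congr EFin; apply/max_r.
  have := max_sum_homo g (T w) _ _ Nn.
  by have := gB w; rewrite ler_norml => /andP[? _]; lra.
- apply: (bounded_integrable (cst B) `|B|) => //.
- by apply/aeW => w n _; rewrite /= lee_fin.
move=> cv.
have : (0 <= \int[P]_w (g w)%:E)%E.
  rewrite -(cvg_lim _ cv) //; apply: lime_ge; first by apply/cvg_ex; eexists; exact: cv.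
  apply: nearW => n /=.
  rewrite -[leRHS]fineK ?lee_fin; first exact: Rintegral_max_sum_ge0.
  by apply: integrable_fin_num => //; exact: (bounded_integrable _ B).
move=> /fine_ge0; rewrite leNgt => /negP; exact.
Qed.

Lemma ae_birkhoff_sum_le (f : Omega -> R) B (eta : R) : measurable_fun setT f ->
  (forall w, `|f w| <= B) -> 0 < eta ->
  {ae P, forall w, exists C, forall n,
     \sum_(i < n) f (iter i T w) <= n%:R * (\int[P]_w f w + eta) + C}.
Proof.
move=> mf fB eta0; set m := \int[P]_w f w.
have Cst r : \int[P]_(w in setT) r = r.
  rewrite Rintegral_cst // (_ : fine _ = 1) ?mulr1 //.
  exact: (congr1 fine (probability_setT P)).
have := ae_bounded_max_sum (fun w => f w - (m + eta)) (B + `|m + eta|).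
case.
- exact: measurable_funB.
- by move=> w; apply: le_trans (ler_normB _ _) _; rewrite lerD2r.
- rewrite RintegralB //; last 2 first.
  + exact: (bounded_integrable _ B).
  + exact: (bounded_integrable _ `|m + eta|).
  by rewrite Cst -/m; lra.
move=> N [mN PN0 sN]; exists N; split => // w /= H; apply: sN => /= -[C HC].
apply: H; exists C => n; have := HC n.
have := birkhoff_sum_le_max_sum (fun w => f w - (m + eta)) n w.
by rewrite sumrB sumr_const card_ord -mulr_natl; lra.
Qed.

End birkhoff.

(** * Dynamic programming *)

Section walks.
Context {R : realType}.
Implicit Types (x y : int) (n : nat).

Definition scons {n} (b : bool) (z : {ffun 'I_n -> bool}) : {ffun 'I_n.+1 -> bool} :=
  [ffun i => oapp z b (unlift ord0 i)].

Lemma scons_bij n :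
  bijective (fun bz : bool * {ffun 'I_n -> bool} => scons bz.1 bz.2).
Proof.
exists (fun z : {ffun 'I_n.+1 -> bool} => (z ord0, [ffun i => z (lift ord0 i)])).
  move=> [b z] /=; rewrite ffunE unlift_none /=; congr pair.
  by apply/ffunP => i; rewrite !ffunE liftK.
move=> z; apply/ffunP => i; rewrite ffunE.
by case: unliftP => [j ->|->] //=; rewrite ffunE.
Qed.

Lemma walk0 n x (z : {ffun 'I_n -> bool}) : walk x z 0 = x.
Proof. by rewrite /walk big_pred0 ?addr0. Qed.

Lemma walkS n x b (z : {ffun 'I_n -> bool}) k :
  walk x (scons b z) k.+1 = walk (x + step b) z k.
Proof.
rewrite /walk big_mkcond big_ord_recl /= ffunE unlift_none /= addrA; congr (_ + _).
rewrite [RHS]big_mkcond; apply: eq_bigr => i _.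
by rewrite ffunE liftK /= /bump /= add1n ltnS.
Qed.

Lemma walk_dist n x (z : {ffun 'I_n -> bool}) k : `|walk x z k - x| <= n%:Z.
Proof.
rewrite /walk addrC addKr; apply: le_trans (ler_norm_sum _ _ _) _.
rewrite big_mkcond /=; apply: (@le_trans _ _ (\sum_(j < n) 1)).
  by apply: ler_sum => j _; case: ifP => // _; case: (z j).
by rewrite sumr_const card_ord -[n in leRHS]mulr1n natz.
Qed.

Lemma walk_norm n x (z : {ffun 'I_n -> bool}) k :
  `|(walk x z k)%:~R| <= `|x%:~R| + n%:R :> R.
Proof.
have : `|(walk x z k - x)%:~R| <= n%:R :> R.
  by rewrite -intr_norm -[n%:R]/(n%:Z%:~R) ler_int walk_dist.
rewrite intrB; have := ler_normD ((walk x z k)%:~R - x%:~R) (x%:~R : R).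
by rewrite subrK; lra.
Qed.

Lemma path_prob_cons n (p : 'I_n.+1 -> int -> bool -> R) x b
    (z : {ffun 'I_n -> bool}) :
  path_prob p x (scons b z)
  = p ord0 x b * path_prob (fun i => p (lift ord0 i)) (x + step b) z.
Proof.
rewrite /path_prob big_ord_recl walk0 ffunE unlift_none; congr (_ * _).
by apply: eq_bigr => i _; rewrite walkS ffunE liftK.
Qed.

Lemma path_expect_cons n (p : 'I_n.+1 -> int -> bool -> R) x F :
  path_expect p x F
  = \sum_b p ord0 x b * path_expect (fun i => p (lift ord0 i)) (x + step b)
      (fun X => F (fun k => if k is k'.+1 then X k' else x)).
Proof.
rewrite /path_expect (reindex _ (onW_bij _ (scons_bij n))) /=.
rewrite -(pair_bigA _ (fun b z => path_prob p x (scons b z) * F (walk x (scons b z)))).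
apply: eq_bigr => b _; rewrite big_distrr; apply: eq_bigr => z _ /=.
rewrite path_prob_cons mulrA; congr (_ * F _).
by apply/funext => -[|k]; rewrite ?walk0 ?walkS.
Qed.

Lemma path_expectZ n (p : 'I_n -> int -> bool -> R) x r F :
  path_expect p x (fun X => r * F X) = r * path_expect p x F.
Proof.
by rewrite /path_expect mulr_sumr; apply: eq_bigr => z _; rewrite mulrCA.
Qed.

Lemma path_prob_ge0 n (p : 'I_n -> int -> bool -> R) x z :
  (forall i y b, 0 <= p i y b) -> 0 <= path_prob p x z.
Proof. by move=> p0; apply: prodr_ge0. Qed.

Lemma path_expect_le n (p : 'I_n -> int -> bool -> R) x F1 F2 :
  (forall i y b, 0 <= p i y b) -> (forall z : {ffun 'I_n -> bool}, F1 (walk x z)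
    <= F2 (walk x z)) ->
  path_expect p x F1 <= path_expect p x F2.
Proof.
move=> p0 F12; apply: ler_sum => z _.
by rewrite ler_wpM2l // path_prob_ge0.
Qed.

End walks.

(** * Sub- and supersolutions of the dynamic programming equation *)

Section comparison.
Context {R : realType}.
Variables (V : int -> R) (beta delta : R).
Implicit Types (G : int -> R) (mu q : R).

Definition subsolution mu G := forall y q, `|2 * q - 1| <= delta ->
  expR mu * G y <= expR (beta * V y) * (q * G (y + 1) + (1 - q) * G (y - 1)).

Definition supersolution mu G := forall y, exists2 q : R, `|2 * q - 1| <= delta &
  expR (beta * V y) * (q * G (y + 1) + (1 - q) * G (y - 1)) <= expR mu * G y.

Definition controlled {n} (p : 'I_n -> int -> bool -> R) :=
  forall i y, p i y false = 1 - p i y true /\ `|2 * p i y true - 1| <= delta.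

Definition potential_expect {n} (p : 'I_n -> int -> bool -> R) x G :=
  path_expect p x (fun X => expR (beta * \sum_(i < n) V (X i)) * G (X n)).

Lemma potential_expect0 (p : 'I_0 -> int -> bool -> R) x G :
  potential_expect p x G = G x.
Proof.
rewrite /potential_expect /path_expect.
rewrite (eq_bigr (fun=> G x)) => [|z _].
  by rewrite sumr_const card_ffun card_ord expn0 mulr1n.
by rewrite /path_prob !big_ord0 mulr0 expR0 !mul1r walk0.
Qed.

Lemma potential_expectS n (p : 'I_n.+1 -> int -> bool -> R) x G :
  potential_expect p x G = expR (beta * V x) *
    \sum_b p ord0 x b * potential_expect (fun i => p (lift ord0 i)) (x + step b) G.
Proof.
rewrite /potential_expect path_expect_cons mulr_sumr; apply: eq_bigr => b _.
rewrite [RHS]mulrCA; congr (_ * _); rewrite -path_expectZ.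
congr (path_expect _ _ _); apply/funext => X; rewrite mulrA -expRD -mulrDr big_ord_recl;
  congr (expR (_ * (_ + _)) * _).
Qed.

Hypothesis delta1 : delta <= 1.

Lemma controlled_ge0 {n} (p : 'I_n -> int -> bool -> R) :
  controlled p -> forall i y b, 0 <= p i y b.
Proof.
move=> hp i y b; have [pf] := hp i y.
have d1 := delta1.
by rewrite ler_norml => /andP[? ?]; case: b; rewrite ?pf; lra.
Qed.

Lemma controlledS {n} (p : 'I_n.+1 -> int -> bool -> R) :
  controlled p -> controlled (fun i => p (lift ord0 i)).
Proof. by move=> hp i y. Qed.

Lemma subsolution_expect mu G n (p : 'I_n -> int -> bool -> R) x :
  subsolution mu G -> controlled p ->
  expR (mu * n%:R) * G x <= potential_expect p x G.
Proof.
move=> hG; elim: n p x => [|n IH] p x hp.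
  by rewrite potential_expect0 mulr0 expR0 mul1r.
rewrite potential_expectS; have [pf pd] := hp ord0 x.
rewrite -natr1 mulrDr mulr1 expRD -mulrA.
apply: le_trans (ler_wpM2l (expR_ge0 _) (hG x _ pd)) _.
rewrite mulrCA ler_wpM2l ?expR_ge0 // -pf mulrDr big_bool.
have p0 := controlled_ge0 p hp ord0 x.
by apply: lerD; rewrite mulrCA ler_wpM2l //; apply: IH; exact: controlledS.
Qed.

(** Fixing an admissible [q] at every site gives one time-homogeneous policy, good for all horizons
    and all starting points. *)
Lemma supersolution_expect mu G : supersolution mu G ->
  exists q : int -> R, (forall y, `|2 * q y - 1| <= delta) /\
  forall n x, potential_expect (n := n)
    (fun _ y b => if b then q y else 1 - q y) x G <= expR (mu * n%:R) * G x.
Proof.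
move=> hG; have d1 := delta1.
have /choice[q hq] y : exists q, `|2 * q - 1| <= delta /\
    expR (beta * V y) * (q * G (y + 1) + (1 - q) * G (y - 1)) <= expR mu * G y.
  by have [q] := hG y; exists q.
exists q; split => [y|n x]; first by have [] := hq y.
elim: n x => [|n IH] x; first by rewrite potential_expect0 mulr0 expR0 mul1r.
have [qd hGx] := hq x.
rewrite potential_expectS -natr1 mulrDr mulr1 expRD -mulrA.
apply: le_trans (ler_wpM2l (expR_ge0 (mu * n%:R)) hGx).
rewrite mulrCA ler_wpM2l ?expR_ge0 // mulrDr big_bool.
move: qd; rewrite ler_norml => /andP[? ?].
by apply: lerD; rewrite [leRHS]mulrCA ler_wpM2l //; lra.
Qed.

End comparison.

(** * Growth rates obtained from sub- and supersolutions *)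

Section growth_bounds.
Context {R : realType}.
Implicit Types (V : int -> R) (beta delta mu theta eta : R) (x y : int) (n : nat).

(* Together, [lower_growth] and [upper_growth] give the growth rate
   mu n + theta x + o(n + |x|) of the value function, see [u_bounds]. *)
Definition lower_growth V beta delta mu theta := forall eta, 0 < eta ->
  exists C, forall x, exists G, [/\ subsolution V beta delta (mu - eta) G,
    forall y, G y <= expR (theta * y%:~R + eta * (`|x%:~R| + `|y%:~R|) + C)
  & expR (theta * x%:~R - eta * `|x%:~R| - C) <= G x].

Definition upper_growth V beta delta mu theta := forall eta, 0 < eta ->
  exists C, forall x, exists G, [/\ supersolution V beta delta (mu + eta) G,
    forall y, expR (theta * y%:~R - eta * (`|x%:~R| + `|y%:~R|) - C) <= G y
  & G x <= expR (theta * x%:~R + eta * `|x%:~R| + C)].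

Lemma potential_expect_le V beta delta n (p : 'I_n -> int -> bool -> R) x G1 G2 :
  delta <= 1 -> controlled delta p ->
  (forall y, `|y%:~R| <= `|x%:~R| + n%:R :> R -> G1 y <= G2 y) ->
  potential_expect V beta p x G1 <= potential_expect V beta p x G2.
Proof.
move=> d1 hp G12; apply: path_expect_le; first exact: controlled_ge0 hp.
by move=> z; rewrite ler_wpM2l ?expR_ge0 // G12 // walk_norm.
Qed.

Lemma potential_expectZ V beta n (p : 'I_n -> int -> bool -> R) x r G :
  potential_expect V beta p x (fun y => r * G y) = r * potential_expect V beta p x G.
Proof.
by rewrite -path_expectZ; congr path_expect; apply/funext => X; rewrite mulrCA.
Qed.

Lemma lower_growth_expect V beta delta mu theta : delta <= 1 ->
  lower_growth V beta delta mu theta -> forall eta, 0 < eta ->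
  exists C, forall n (p : 'I_n -> int -> bool -> R) x, controlled delta p ->
    expR (mu * n%:R + theta * x%:~R - eta * (n%:R + `|x%:~R|) - C)
    <= potential_expect V beta p x (fun y => expR (theta * y%:~R)).
Proof.
(* The error in [|x|] is paid three times: once at the start and twice at the end, where [|x| + |y|]
   is at most [2 * |x| + n]. *)
move=> d1 H eta eta0; have [C HC] := H (eta / 3) (divr_gt0 eta0 (ltr0Sn R 2)).
exists (2 * C) => n p x hp; have [G [subG Gle Gx]] := HC x.
have en0 : 0 <= eta * n%:R by rewrite mulr_ge0 // ltW.
set A := eta / 3 * (`|x%:~R| + (`|x%:~R| + n%:R)) + C.
have : potential_expect V beta p x G <=
    potential_expect V beta p x (fun y => expR A * expR (theta * y%:~R)).
  apply: potential_expect_le hp _ => // y yx.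
  apply: le_trans (Gle y) _; rewrite -expRD ler_expR /A.
  have : eta / 3 * `|y%:~R| <= eta / 3 * (`|x%:~R| + n%:R).
    by rewrite ler_wpM2l // divr_ge0 // ltW.
  lra.
rewrite potential_expectZ -ler_pdivrMl ?expR_gt0 // => /(le_trans _); apply.
rewrite ler_pdivlMl ?expR_gt0 //.
apply: le_trans (subsolution_expect _ _ _ d1 _ _ _ _ _ subG hp).
apply: le_trans (ler_wpM2l (expR_ge0 _) Gx).
rewrite -!expRD ler_expR /A; lra.
Qed.

Lemma upper_growth_expect V beta delta mu theta : delta <= 1 ->
  upper_growth V beta delta mu theta -> forall eta, 0 < eta ->
  exists C, forall n x, exists p : 'I_n -> int -> bool -> R,
    controlled delta p /\
    potential_expect V beta p x (fun y => expR (theta * y%:~R))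
    <= expR (mu * n%:R + theta * x%:~R + eta * (n%:R + `|x%:~R|) + C).
Proof.
move=> d1 H eta eta0; have [C HC] := H (eta / 3) (divr_gt0 eta0 (ltr0Sn R 2)).
exists (2 * C) => n x; have [G [supG Gle Gx]] := HC x.
have [q [qd hq]] := supersolution_expect _ _ _ d1 _ _ supG.
have hp : controlled (n := n) delta (fun _ y b => if b then q y else 1 - q y) by [].
eexists; split; first exact: hp.
have en0 : 0 <= eta * n%:R by rewrite mulr_ge0 // ltW.
set A := eta / 3 * (`|x%:~R| + (`|x%:~R| + n%:R)) + C.
apply: (@le_trans _ _ (potential_expect V beta
    (fun (_ : 'I_n) y (b : bool) => if b then q y else 1 - q y) x
    (fun y => expR A * G y))).
  apply: potential_expect_le hp _ => // y yx.
  rewrite -ler_pdivrMl ?expR_gt0 // -expRN -expRD; apply: le_trans (Gle y).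
  rewrite ler_expR /A.
  have : eta / 3 * `|y%:~R| <= eta / 3 * (`|x%:~R| + n%:R).
    by rewrite ler_wpM2l // divr_ge0 // ltW.
  lra.
rewrite potential_expectZ -ler_pdivlMl ?expR_gt0 // -expRN.
apply: le_trans (hq n x) _; apply: le_trans (ler_wpM2l (expR_ge0 _) Gx) _.
rewrite -!expRD ler_expR /A; lra.
Qed.

Lemma subsolution_opp V beta delta mu G :
  subsolution (V \o -%R) beta delta mu G -> subsolution V beta delta mu (G \o -%R).
Proof.
move=> H y q hq; have := H (- y) (1 - q); rewrite /= opprK.
have -> : - (y + 1) = - y - 1 by ring.
have -> : - (y - 1) = - y + 1 by ring.
have -> : 2 * (1 - q) - 1 = - (2 * q - 1) by ring.
rewrite normrN => /(_ hq) /le_trans; apply; rewrite ler_wpM2l ?expR_ge0 //.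
lra.
Qed.

Lemma supersolution_opp V beta delta mu G :
  supersolution (V \o -%R) beta delta mu G ->
  supersolution V beta delta mu (G \o -%R).
Proof.
move=> H y; have [q hq Hq] := H (- y); exists (1 - q).
  have -> : 2 * (1 - q) - 1 = - (2 * q - 1) by ring.
  by rewrite normrN.
move: Hq; rewrite /= opprK; apply: le_trans.
have -> : - (y + 1) = - y - 1 by ring.
have -> : - (y - 1) = - y + 1 by ring.
rewrite ler_wpM2l ?expR_ge0 //; lra.
Qed.

Lemma lower_growth_opp V beta delta mu theta :
  lower_growth (V \o -%R) beta delta mu theta -> lower_growth V beta delta mu (- theta).
Proof.
move=> H eta eta0; have [C HC] := H eta eta0; exists C => x.
have [G [subG Gle Gx]] := HC (- x); exists (G \o -%R); split.
- exact: subsolution_opp.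
- by move=> y; apply: le_trans (Gle (- y)) _; rewrite !rmorphN !normrN mulrN mulNr.
- by apply: le_trans Gx; rewrite rmorphN normrN mulrN mulNr.
Qed.

Lemma upper_growth_opp V beta delta mu theta :
  upper_growth (V \o -%R) beta delta mu theta -> upper_growth V beta delta mu (- theta).
Proof.
move=> H eta eta0; have [C HC] := H eta eta0; exists C => x.
have [G [subG Gle Gx]] := HC (- x); exists (G \o -%R); split.
- exact: supersolution_opp.
- by move=> y; apply: le_trans (Gle (- y)); rewrite !rmorphN !normrN mulrN mulNr.
- by apply: le_trans Gx _; rewrite rmorphN normrN mulrN mulNr.
Qed.

End growth_bounds.

(** * Scaling limits of the value function and of the free energy *)

Section limits.
Context {d : measure_display} {Omega : measurableType d} {R : realType}.
Variables (T Ti : Omega -> Omega) (V : Omega -> R).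
Implicit Types (beta delta mu theta eta : R) (x y : int) (n : nat) (w : Omega).

Definition env w y := V (Tpow T Ti y w).

Lemma exp_costE beta theta n w x (p : 'I_n -> int -> bool -> R) :
  path_expect p x (exp_cost T Ti V beta theta n w)
  = potential_expect (env w) beta p x (fun y => expR (theta * y%:~R)).
Proof. by congr path_expect; apply/funext => X; rewrite /exp_cost expRD. Qed.

Lemma u_bounds delta beta theta mu w : 0 <= delta <= 1 ->
  lower_growth (env w) beta delta mu theta ->
  upper_growth (env w) beta delta mu theta ->
  forall eta, 0 < eta -> exists C, forall n x,
    `|u T Ti V delta beta theta n x w - (mu * n%:R + theta * x%:~R)|
    <= eta * (n%:R + `|x%:~R|) + C.
Proof.
move=> /andP[d0 d1] Hlow Hup eta eta0.
have [C1 H1] := lower_growth_expect _ _ _ _ _ d1 Hlow eta eta0.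
have [C2 H2] := upper_growth_expect _ _ _ _ _ d1 Hup eta eta0.
exists (Num.max C1 C2) => n x; rewrite /u.
set S := image _ _.
have lbS : lbound S (mu * n%:R + theta * x%:~R - eta * (n%:R + `|x%:~R|) - C1).
  move=> _ [pi [_ pi01 pi1 pid] <-]; rewrite exp_costE.
  have hpi : controlled delta (fun i => pi i w).
    move=> i y; have pif : pi i w y false = 1 - pi i w y true.
      by have := pi1 i w y; lra.
    split => //; apply: le_trans (pid i w y); rewrite pif.
    by rewrite le_eqVlt; apply/orP; left; apply/eqP; congr `| _ |; ring.
  rewrite -[leLHS]expRK ler_ln ?posrE ?expR_gt0 //; first exact: H1.
  exact: lt_le_trans (expR_gt0 _) (H1 _ _ _ hpi).
have [p [hp Hp]] := H2 n x.
have pS : S (ln (potential_expect (env w) beta p x (fun y => expR (theta * y%:~R)))).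
  (* a policy may ignore [w], so the infimum is taken separately for each environment *)
  exists (fun i _ => p i); last by rewrite exp_costE.
  split => [i y z|i w' y z|i w' y|i w' y].
  - exact: measurable_cst.
  - have [pf] := hp i y; rewrite ler_norml => /andP[? ?].
    by case: z; rewrite ?pf; lra.
  - by have [-> _] := hp i y; ring.
  - have [-> ] := hp i y; apply: le_trans.
    by rewrite le_eqVlt; apply/orP; left; apply/eqP; congr `| _ |; ring.
have infS : inf S <= mu * n%:R + theta * x%:~R + eta * (n%:R + `|x%:~R|) + C2.
  apply: le_trans (ge_inf _ pS) _; first by eexists; exact: lbS.
  rewrite -[leRHS]expRK ler_ln ?posrE ?expR_gt0 //.
  exact: lt_le_trans (expR_gt0 _) (H1 _ _ _ hp).
have Sinf := lb_le_inf (ex_intro _ _ pS) lbS.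
have : C1 <= Num.max C1 C2 /\ C2 <= Num.max C1 C2 by rewrite !le_max !lexx orbT.
by rewrite ler_norml; move: (Num.max C1 C2) => M [? ?]; lra.
Qed.

Lemma scaled_u_cvg delta beta theta mu w (t x : R) : 0 <= delta <= 1 ->
  lower_growth (env w) beta delta mu theta ->
  upper_growth (env w) beta delta mu theta -> 0 < t ->
  scaled_u T Ti V delta beta theta w t x eps @[eps --> 0^'+] --> t * mu + theta * x.
Proof.
move=> d01 Hlow Hup t0.
suff H (e : R) : 0 < e -> \forall eps \near 0^'+,
    `|t * mu + theta * x - scaled_u T Ti V delta beta theta w t x eps| <= e.
  by apply/cvgrPdist_le => e; exact: H.
move=> e0.
(* [eps * (n + |m|)] stays below [K], so the linear error of [u_bounds] costs at most [e / 2]. The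
   constant [A] below collects the additive error and the two rounding errors, all of order
   [eps]. *)
pose K : R := t + `|x| + 2; have K0 : 0 < K by rewrite /K; have := normr_ge0 x; lra.
have [C HC] := u_bounds _ _ _ _ _ d01 Hlow Hup (e / (2
  * K)) (divr_gt0 e0 (mulr_gt0 (ltr0Sn _ 1) K0)).
pose A : R := `|C| + `|mu| + `|theta|.
have A0 : 0 <= A by rewrite !addr_ge0.
near=> eps.
have eps0 : 0 < eps by near: eps; exact: nbhs_right_gt.
have eps1 : eps <= 1 by near: eps; exact: nbhs_right_le.
have epsA : eps <= e / (2 * (A + 1)).
  by near: eps; apply: nbhs_right_le; rewrite divr_gt0 // mulr_gt0 //; lra.
rewrite /scaled_u; set n := Num.truncn _; set m := Num.floor _.
have /andP[n1 n2] : n%:R <= eps^-1 * t < n.+1%:R.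
  by apply: truncn_itv; rewrite mulr_ge0 ?invr_ge0 // ltW.
have /andP[m1 m2] : m%:~R <= eps^-1 * x < (m + 1)%:~R by exact: floor_itv.
have {}n1 : eps * n%:R <= t by rewrite -ler_pdivlMl.
have {}n2 : t < eps * n%:R + eps.
  by move: n2; rewrite -natr1 -ltr_pdivlMl ?invr_gt0 // invrK; lra.
have {}m1 : eps * m%:~R <= x by rewrite -ler_pdivlMl.
have {}m2 : x < eps * m%:~R + eps.
  by move: m2; rewrite intrD -ltr_pdivlMl ?invr_gt0 // invrK; lra.
have Hu := ler_wpM2l (ltW eps0) (HC n m).
move: Hu; move: (u _ _ _ _ _ _ n m w) => un Hu.
have -> : t * mu + theta * x - eps * un
    = mu * (t - eps * n%:R) + theta * (x - eps * m%:~R)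
      - eps * (un - (mu * n%:R + theta * m%:~R)) by ring.
apply: le_trans (ler_normB _ _) _; apply: le_trans (lerD (ler_normD _ _) (lexx _)) _.
rewrite !normrM (gtr0_norm eps0).
have Hn : `|mu| * `|t - eps * n%:R| <= `|mu| * eps.
  by rewrite ler_wpM2l // ger0_norm; lra.
have Hm : `|theta| * `|x - eps * m%:~R| <= `|theta| * eps.
  by rewrite ler_wpM2l // ger0_norm; lra.
have Hnm : e / (2 * K) * (eps * n%:R + eps * `|m%:~R|) <= e / 2.
  have -> : e / 2 = e / (2 * K) * K by field; rewrite gt_eqF.
  rewrite ler_wpM2l ?divr_ge0 ?mulr_ge0 // ?ltW //.
  have : `|eps * m%:~R| <= `|x| + `|eps * m%:~R - x|.
    by rewrite -{1}[eps * m%:~R](subrK x) addrC; apply: ler_normD.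
  rewrite normrM (gtr0_norm eps0) distrC (ger0_norm (_ : 0 <= x - eps * m%:~R)).
    by rewrite /K; lra.
  lra.
have HA : eps * A <= e / 2.
  apply: le_trans (ler_wpM2r A0 epsA) _.
  have -> : e / (2 * (A + 1)) * A = e / 2 * (A / (A + 1)) by field; lra.
  rewrite -[leRHS]mulr1 ler_wpM2l ?divr_ge0 ?(ltW e0) // ler_pdivrMr; lra.
have HC1 : eps * C <= eps * `|C| by rewrite ler_wpM2l ?ler_norm // ltW.
have -> : e = e / 2 + e / 2 by field.
apply: le_trans (lerD Hnm HA); rewrite /A; lra.
Unshelve. all: by end_near. Qed.

Lemma u_o_eq delta beta theta mu w (t x : R) : 0 <= delta <= 1 ->
  lower_growth (env w) beta delta mu theta ->
  upper_growth (env w) beta delta mu theta -> 0 < t ->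
  u_o T Ti V delta beta theta w t x = t * mu + theta * x.
Proof. by move=> *; apply: cvg_lim => //; apply: scaled_u_cvg. Qed.

(** For [delta = 0] the constraint forces [q = 1/2]: simple random walk is the only controlled walk,
    so both growth bounds apply to it. *)
Lemma free_energy_cvg beta theta mu w :
  lower_growth (env w) beta 0 mu theta ->
  upper_growth (env w) beta 0 mu theta ->
  n%:R^-1 * ln (path_expect (n := n) srw 0 (exp_cost T Ti V beta theta n w))
    @[n --> \oo] --> mu.
Proof.
move=> Hlow Hup.
suff H (e : R) : 0 < e -> \forall n \near \oo, `|mu - n%:R^-1 *
    ln (path_expect (n := n) srw 0 (exp_cost T Ti V beta theta n w))| <= e.
  by apply/cvgrPdist_le => e; exact: H.
move=> e0.
have srw0 n : controlled (n := n) (0 : R) srw.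
  move=> i y; rewrite /srw; split; first by field.
  by rewrite mulfV ?subrr ?normr0 // pnatr_eq0.
have e20 : 0 < e / 2 by rewrite divr_gt0.
have [C1 H1] := lower_growth_expect _ _ _ _ _ ler01 Hlow _ e20.
have [C2 H2] := upper_growth_expect _ _ _ _ _ ler01 Hup _ e20.
pose C : R := `|C1| + `|C2|; have C0 : 0 <= C by rewrite addr_ge0.
near=> n.
have n0 : (0 < n)%N by near: n; exact: nbhs_infty_gt.
have nC : C <= n%:R * (e / 2).
  rewrite -ler_pdivrMr //; near: n; exact: nbhs_infty_ger.
have n0' : 0 < n%:R :> R by rewrite ltr0n.
have E1 := H1 n srw 0 (srw0 n).
have E2 : potential_expect (env w) beta (srw (n := n)) 0 (fun y => expR (theta * y%:~R))
    <= expR (mu * n%:R + theta * 0%:~R + e / 2 * (n%:R + `|0%:~R|) + C2).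
  have [p [hp]] := H2 n 0; congr (_ <= _).
  congr potential_expect; apply/funext => i; apply/funext => y; apply/funext => b.
  have [pf] := hp i y; rewrite normr_le0 subr_eq0 => /eqP pt.
  have {}pt : p i y true = 2^-1 by lra.
  by rewrite /srw; case: b; rewrite ?pf pt //; field.
rewrite exp_costE; move: E1 E2; move: (potential_expect _ _ _ _ _) => E.
rewrite mulr0z normr0 addr0 mulr0 addr0 => E1 E2.
have E0 : 0 < E := lt_le_trans (expR_gt0 _) E1.
have {}E1 : mu * n%:R - e / 2 * n%:R - C1 <= ln E.
  by rewrite -ler_expR lnK ?posrE.
have {}E2 : ln E <= mu * n%:R + e / 2 * n%:R + C2.
  by rewrite -ler_expR lnK ?posrE.
have -> : mu - n%:R^-1 * ln E = n%:R^-1 * (mu * n%:R - ln E).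
  by field; rewrite gt_eqF.
rewrite normrM gtr0_norm ?invr_gt0 // ler_pdivrMl // ler_norml.
have := ler_norm C1; have := ler_norm C2; have := normr_ge0 C1; have := normr_ge0 C2.
by rewrite /C in nC *; lra.
Unshelve. all: by end_near. Qed.

End limits.

(** * Positive solutions of the difference equation *)

Section slopes.
Context {R : realType}.
Implicit Types (F G : int -> R) (a b r : R) (x y : int) (n : nat).

Definition slope F a := forall eta, 0 < eta ->
  exists C : R, forall x, `|F x - a * x%:~R| <= eta * `|x%:~R| + C.

Lemma slope_ge0_bound F a eta : slope F a -> 0 < eta ->
  exists2 C : R, 0 <= C & forall x, `|F x - a * x%:~R| <= eta * `|x%:~R| + C.
Proof.
move=> sF eta0; have [C HC] := sF eta eta0; exists C => //.
by have := HC 0; rewrite mulr0z normr0 !mulr0 add0r; apply: le_trans.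
Qed.

Lemma slope_linear a : slope (fun x => a * x%:~R) a.
Proof.
by move=> eta eta0; exists 0 => x; rewrite subrr normr0 addr0 mulr_ge0 // ltW.
Qed.

Lemma slopeD F G a b : slope F a -> slope G b -> slope (fun x => F x + G x) (a + b).
Proof.
move=> HF HG eta eta0; have eta20 : 0 < eta / 2 by rewrite divr_gt0.
have [C1 H1] := HF _ eta20; have [C2 H2] := HG _ eta20; exists (C1 + C2) => x.
have -> : F x + G x - (a + b) * x%:~R = (F x - a * x%:~R) + (G x - b * x%:~R) by ring.
apply: le_trans (ler_normD _ _) _; have := H1 x; have := H2 x; lra.
Qed.

Lemma slopeZ F a r : slope F a -> slope (fun x => r * F x) (r * a).
Proof.
move=> HF eta eta0; have r0 : 0 < `|r| + 1 by rewrite ltr_wpDl.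
have [C HC] := HF (eta / (`|r| + 1)) (divr_gt0 eta0 r0).
exists (`|r| * C) => x; rewrite -mulrA -mulrBr normrM.
apply: le_trans (ler_wpM2l (normr_ge0 _) (HC x)) _.
rewrite mulrDr lerD2r mulrA ler_wpM2r // mulrA ler_pdivrMr // mulrC ler_wpM2l ?ltW //.
by rewrite ltrDl.
Qed.

Lemma slope_opp F a : slope F a -> slope (F \o -%R) (- a).
Proof.
move=> HF eta eta0; have [C HC] := HF _ eta0; exists C => x.
by have := HC (- x); rewrite /= rmorphN normrN mulrN mulNr.
Qed.

Lemma slope_le F G a b r : slope F a -> slope G b ->
  (forall n, F n%:Z <= G n%:Z + r) -> a <= b.
Proof.
move=> HF HG FG; rewrite leNgt; apply/negP => ba.
have e0 : 0 < (a - b) / 4 by rewrite divr_gt0 // subr_gt0.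
have [C1 H1] := HF _ e0; have [C2 H2] := HG _ e0.
(* With tolerance [(a - b) / 4] for each function, [(a - b) / 2 * n] would have to stay below
   [r + C1 + C2]; this [n] is too large for that. *)
pose n := (Num.truncn (`|2 * (r + C1 + C2) / (a - b)|)).+1.
have := truncnS_gt `|2 * (r + C1 + C2) / (a - b)|; rewrite -/n.
move=> /(le_lt_trans (ler_norm _)); rewrite ltr_pdivrMr ?subr_gt0 //.
have := FG n; have := H1 n%:Z; have := H2 n%:Z.
rewrite -[n%:Z%:~R]/(n%:R) !ler_norml (ger0_norm (ler0n R n)) => /andP[? ?] /andP[? ?].
lra.
Qed.

Lemma slope_le_incr F G a b : slope F a -> slope G b ->
  (forall x, F (x + 1) - F x <= G (x + 1) - G x) -> a <= b.
Proof.
move=> HF HG FG; apply: (slope_le F G a b (F 0 - G 0) HF HG).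
elim=> [|n IH]; first by lra.
by have := FG n%:Z; rewrite -[n%:Z + 1]/((n + 1)%N%:Z) addn1; lra.
Qed.

End slopes.

(** * Contraction of the ratio recursion *)

Section ratios.
Context {R : realType}.
Implicit Types (r a : int -> R) (k D : R) (x y : int) (N : nat).

(* The relation is a contraction in the ratio, so far away values of [a1] and [a2]
   only matter through [k ^+ N]. *)
Lemma ratio_cmp_trunc k D r1 r2 a1 a2 : k < 1 -> 0 <= D ->
  (forall y, 0 < r1 y <= k) -> (forall y, 0 < r2 y <= k) ->
  (forall y, (r1 y)^-1 + r1 (y + 1) = a1 y) ->
  (forall y, (r2 y)^-1 + r2 (y + 1) = a2 y) ->
  forall N y, (forall i : nat, (i < N)%N -> a2 (y + i%:Z) - a1 (y + i%:Z) <= D) ->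
  r1 y - r2 y <= D / (1 - k) + k ^+ N.
Proof.
move=> k1 D0 Hr1 Hr2 E1 E2; have s0 : 0 <= D / (1 - k) by rewrite divr_ge0 // subr_ge0 ltW.
have k0 : 0 < k by have /andP[] := Hr1 0; apply: lt_le_trans.
elim=> [|N IH] y H.
  rewrite expr0; have /andP[? ?] := Hr1 y; have /andP[? ?] := Hr2 y; lra.
have {}IH : r1 (y + 1) - r2 (y + 1) <= D / (1 - k) + k ^+ N.
  by apply: IH => i iN; rewrite -addrA -intS; exact: H.
have /andP[r10 r1k] := Hr1 y; have /andP[r20 r2k] := Hr2 y.
have HD := H 0%N isT; rewrite addr0 in HD.
have -> : r1 y - r2 y = r1 y * r2 y * ((a2 y - a1 y) + (r1 (y + 1) - r2 (y + 1))).
  by rewrite -E1 -E2; field; rewrite !gt_eqF.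
have kN0 : 0 <= k ^+ N by rewrite exprn_ge0 // ltW.
set B := D + (D / (1 - k) + k ^+ N).
have B0 : 0 <= B by rewrite /B; lra.
apply: (@le_trans _ _ (r1 y * r2 y * B)).
  apply: ler_wpM2l; first by rewrite mulr_ge0 // ltW.
  exact: lerD.
apply: (@le_trans _ _ (k * B)).
  apply: ler_wpM2r => //; rewrite -[leRHS]mulr1.
  by apply: ler_pM; rewrite ?(ltW r10) ?(ltW r20) // (le_trans r2k) // ltW.
(* The factor [1 - (1 - k) ^+ 2] is at most [1], so the error bound [D / (1 - k)] reproduces itself
   along the induction. *)
have -> : k * B = (1 - (1 - k) ^+ 2) * (D / (1 - k)) + k ^+ N.+1.
  by rewrite /B [k ^+ N.+1]exprS; field; rewrite gt_eqF // subr_gt0.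
by rewrite lerD2r ler_piMl // gerBl sqr_ge0.
Qed.

Lemma ratio_cmp k D r1 r2 a1 a2 : k < 1 -> 0 <= D ->
  (forall y, 0 < r1 y <= k) -> (forall y, 0 < r2 y <= k) ->
  (forall y, (r1 y)^-1 + r1 (y + 1) = a1 y) ->
  (forall y, (r2 y)^-1 + r2 (y + 1) = a2 y) ->
  (forall y, a2 y - a1 y <= D) ->
  forall y, r1 y - r2 y <= D / (1 - k).
Proof.
move=> k1 D0 Hr1 Hr2 E1 E2 H y; apply/ler_addgt0Pr => e e0.
have k0 : 0 < k by have /andP[] := Hr1 0; apply: lt_le_trans.
have kn : `|k| < 1 by rewrite gtr0_norm.
have /cvgrPdist_le /(_ e e0) [N _ /(_ N (leqnn N)) /=] := cvg_expr kn.
rewrite sub0r normrN normrX (gtr0_norm k0) => kN.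
apply: le_trans (ratio_cmp_trunc _ _ _ _ _ _ k1 D0 Hr1 Hr2 E1 E2 N y _) _ => //.
by rewrite lerD2l.
Qed.

End ratios.

(** * Decaying solutions and their rates *)

Section decaying_solutions.
Context {R : realType}.
Implicit Types (V : int -> R) (beta lam g c h m M D : R) (f : int -> R) (x y : int).

(* The decaying positive eigenfunction of exp(beta V) times the simple random walk
   transition operator, with eigenvalue exp(lam) and exponential rate g. *)
Definition decaying_solution V beta lam g f :=
  [/\ forall y, 0 < f y,
      forall y, f (y + 1) <= expR (beta - lam) * f y,
      forall y, expR (beta * V y) * (f (y + 1) + f (y - 1)) = 2 * expR lam * f y
    & slope (fun y => ln (f y)) (- g)].

Definition ratio f y := f y / f (y - 1).

Lemma ratioP V beta lam g f : decaying_solution V beta lam g f ->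
  [/\ forall y, 0 < ratio f y <= expR (beta - lam),
      forall y, (ratio f y)^-1 + ratio f (y + 1) = 2 * expR (lam - beta * V y)
    & forall y, ln (f (y + 1)) - ln (f y) = ln (ratio f (y + 1))].
Proof.
move=> [f0 fk fE _]; rewrite /ratio; split => y.
- rewrite divr_gt0 // ler_pdivrMr //.
  by have := fk (y - 1); rewrite subrK.
- have fy := lt0r_neq0 (f0 y).
  rewrite addrK expRB mulrA -[2 * expR lam](mulfK fy) -fE.
  by field; rewrite fy !gt_eqF ?expR_gt0.
- by rewrite addrK ln_div ?posrE.
Qed.

(** By the comparison with [D = 0], a larger [lam - beta * V] makes the ratio smaller at every site,
    hence the decay faster. *)
Lemma decaying_solution_monotone V beta1 lam1 g1 f1 beta2 lam2 g2 f2 :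
  decaying_solution V beta1 lam1 g1 f1 -> decaying_solution V beta2 lam2 g2 f2 ->
  beta1 < lam1 -> beta2 < lam2 ->
  (forall y, lam1 - beta1 * V y <= lam2 - beta2 * V y) -> g1 <= g2.
Proof.
move=> D1 D2 bl1 bl2 H; have [r1k r1E l1] := ratioP _ _ _ _ _ D1.
have [r2k r2E l2] := ratioP _ _ _ _ _ D2.
set k := Num.max (expR (beta1 - lam1)) (expR (beta2 - lam2)).
have k1 : k < 1 by rewrite gt_max !expR_lt1 !subr_lt0 bl1.
have cmp := ratio_cmp k 0 (ratio f2) (ratio f1) _ _ k1 (lexx 0) _ _ r2E r1E.
have {}cmp y : ratio f2 y <= ratio f1 y.
  rewrite -subr_le0; apply: le_trans (cmp _ _ _ y) _; last by rewrite mul0r.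
  - move=> z; have /andP[-> /le_trans] := r2k z; apply.
    by rewrite le_max lexx orbT.
  - move=> z; have /andP[-> /le_trans] := r1k z; apply.
    by rewrite le_max lexx.
  - by move=> z; rewrite subr_le0 ler_pM2l // ler_expR.
case: D1 => _ _ _ s1; case: D2 => _ _ _ s2.
rewrite -lerN2; apply: slope_le_incr s2 s1 _ => y.
rewrite l1 l2 ler_ln ?posrE //; first by have /andP[] := r2k (y + 1).
by have /andP[] := r1k (y + 1).
Qed.

(** The constant has three sources: [2 * expR M] bounds the derivative of [2 * expR] below [M],
    [1 / (1 - expR (- m))] comes from the contraction, and a second [2 * expR M] bounds the inverse
    ratio when differences of ratios become differences of logarithms. *)
Lemma decaying_solution_lipschitz V beta1 lam1 g1 f1 beta2 lam2 g2 f2 m M D :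
  decaying_solution V beta1 lam1 g1 f1 -> decaying_solution V beta2 lam2 g2 f2 ->
  0 < m -> beta1 <= lam1 - m -> beta2 <= lam2 - m -> 0 <= D ->
  (forall y, lam1 - beta1 * V y <= M) -> 
  (forall y, (lam1 - beta1 * V y) - (lam2 - beta2 * V y) <= D) ->
  g1 - g2 <= 4 * expR M ^+ 2 / (1 - expR (- m)) * D.
Proof.
move=> D1 D2 m0 bl1 bl2 D0 HM HD; have [r1k r1E l1] := ratioP _ _ _ _ _ D1.
have [r2k r2E l2] := ratioP _ _ _ _ _ D2.
have k1 : expR (- m) < 1 by rewrite -expR0 ltr_expR oppr_lt0.
have D'0 : 0 <= 2 * expR M * D by rewrite !mulr_ge0 ?expR_ge0.
have cmp := ratio_cmp (expR (- m)) (2 * expR M * D) (ratio f2) (ratio f1) _ _ k1 D'0 _ _ r2E r1E.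
have {}cmp y : ratio f2 y - ratio f1 y <= 2 * expR M * D / (1 - expR (- m)).
  apply: cmp.
  - move=> z; have /andP[-> /le_trans] := r2k z; apply.
    by rewrite ler_expR; lra.
  - move=> z; have /andP[-> /le_trans] := r1k z; apply.
    by rewrite ler_expR; lra.
  - move=> z; rewrite -mulrBr -mulrA ler_pM2l //.
    set A := lam1 - beta1 * V z; set B := lam2 - beta2 * V z.
    have AB : A - B <= D := HD z.
    have -> : expR A - expR B = expR A * (1 - expR (B - A)).
      by rewrite mulrBr mulr1 -expRD [A + _]addrC subrK.
    apply: (@le_trans _ _ (expR A * D)).
      rewrite ler_wpM2l ?expR_ge0 //; have := expR_ge1Dx (B - A); lra.
    by rewrite ler_wpM2r // ler_expR HM.
set K := _ / _ in cmp *; have K0 : 0 <= K by rewrite divr_ge0 // subr_ge0 ltW.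
have -> : 4 * expR M ^+ 2 / (1 - expR (- m)) * D = 2 * expR M * K.
  by rewrite /K; field; rewrite gt_eqF // subr_gt0.
case: D1 => _ _ _ s1; case: D2 => _ _ _ s2.
rewrite lerBlDr -lerBlDl -lerN2 opprB.
have := slopeD _ _ _ _ s1 (slope_linear (2 * expR M * K)) => s1'.
have : - g2 <= - g1 + 2 * expR M * K; last by lra.
apply: slope_le_incr s2 s1' _ => y.
rewrite intrD mulrDr mulr1.
suff : ln (ratio f2 (y + 1)) - ln (ratio f1 (y + 1)) <= 2 * expR M * K.
  by rewrite -l1 -l2; lra.
have /andP[r10 _] := r1k (y + 1); have /andP[r20 _] := r2k (y + 1).
rewrite -ln_div ?posrE //; set q := _ / _.
have -> : q = 1 + (q - 1) by ring.
apply: le_trans (le_ln1Dx _) _; first by rewrite ltrBrDr addNr divr_gt0.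
have -> : q - 1 = (ratio f2 (y + 1) - ratio f1 (y + 1)) * (ratio f1 (y + 1))^-1.
  by rewrite /q; field; rewrite gt_eqF.
apply: (@le_trans _ _ (K * (ratio f1 (y + 1))^-1)).
  by apply: ler_wpM2r; [rewrite invr_ge0 ltW | exact: cmp].
rewrite mulrC ler_wpM2r //.
have := r1E (y + 1); have /andP[r10' _] := r1k (y + 1 + 1).
have : expR (lam1 - beta1 * V (y + 1)) <= expR M by rewrite ler_expR HM.
lra.
Qed.

Lemma decaying_solution_rate_ge V beta lam g f :
  decaying_solution V beta lam g f -> lam - beta <= g.
Proof.
move=> D1; have [rk rE l1] := ratioP _ _ _ _ _ D1; case: D1 => _ _ _ s1.
rewrite -lerN2 opprB; apply: slope_le_incr s1 (slope_linear _) _ => y.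
rewrite l1 intrD mulrDr mulr1 [in leRHS]addrC addKr.
have /andP[r0 rle] := rk (y + 1).
by rewrite -ler_expR lnK ?posrE.
Qed.

Lemma cosh_ge1 c : 1 <= cosh c.
Proof.
rewrite /cosh expRN; set e := expR c; have e0 : 0 < e by rewrite expR_gt0.
rewrite ler_pdivlMr // mul1r -subr_ge0.
have -> : e + e^-1 - 2 = (e - 1) ^+ 2 / e by field; rewrite gt_eqF.
by rewrite divr_ge0 ?sqr_ge0 // ltW.
Qed.

Lemma ln_cosh_lt c : 0 < c -> ln (cosh c) < c.
Proof.
move=> c0; have ch0 : 0 < cosh c by apply: lt_le_trans (cosh_ge1 c).
rewrite -ltr_expR lnK ?posrE //.
have : expR (- c) < expR c by rewrite ltr_expR; lra.
by rewrite /cosh; lra.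
Qed.

Lemma decaying_solution_free V c : 0 < c ->
  decaying_solution V 0 (ln (cosh c)) c (fun y => expR (- c * y%:~R)).
Proof.
move=> c0; have ch0 : 0 < cosh c by apply: lt_le_trans (cosh_ge1 c).
split=> [y|y|y|].
- exact: expR_gt0.
- rewrite -expRD ler_expR intrD mulrDr mulr1 addrC lerD2r sub0r lerN2.
  exact/ltW/ln_cosh_lt.
- rewrite mul0r expR0 mul1r lnK ?posrE // intrD intrB !mulrDr !expRD mulr1.
  by rewrite mulrN1 opprK /cosh; field.
- under [X in slope X]funext do rewrite expRK.
  exact: slope_linear.
Qed.

Lemma decaying_solution_free_rate V g c f : 0 < c -> 0 < ln (cosh c) ->
  decaying_solution V 0 (ln (cosh c)) g f -> g = c.
Proof.
move=> c0 l0 Df; have Dc := decaying_solution_free V c c0.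
apply/le_anti/andP; split.
  exact: (decaying_solution_monotone _ _ _ _ _ _ _ _ _ Df Dc).
exact: (decaying_solution_monotone _ _ _ _ _ _ _ _ _ Dc Df).
Qed.

Section below_free_rate.
Variables (V : int -> R) (beta lam g c : R) (f : int -> R).
Hypotheses (V01 : forall y, 0 <= V y <= 1) (c0 : 0 < c).
Hypotheses (beta0 : 0 <= beta) (beta_lam : beta < lam).
Hypothesis Df : decaying_solution V beta lam g f.

(** As [lam - beta * V <= ln (cosh c)], the ratios of [f] are at least those of the free solution,
    all equal to [expR (- c)]. In other words [expR (c * y) * f y] is nondecreasing, which is what
    makes the extreme drift to the left optimal. *)
Lemma decaying_solution_le_expR : lam <= ln (cosh c) ->
  forall y, f y <= expR c * f (y + 1).
Proof.
move=> lc y; have Dc := decaying_solution_free V c c0.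
have [rk rE _] := ratioP _ _ _ _ _ Df.
have [ck cE _] := ratioP _ _ _ _ _ Dc.
have l0 : 0 < ln (cosh c) by apply: lt_le_trans lc; apply: le_lt_trans beta_lam.
set k := Num.max (expR (beta - lam)) (expR (0 - ln (cosh c))).
have k1 : k < 1.
  by rewrite gt_max !expR_lt1 !subr_lt0 beta_lam l0.
have : ratio (fun y => expR (- c * y%:~R)) (y + 1) - ratio f (y + 1) <= 0 / (1 - k).
  apply: (ratio_cmp _ _ _ _ _ _ k1 (lexx 0) _ _ cE rE).
  - by move=> z; have /andP[-> /le_trans] := ck z; apply; rewrite le_max lexx orbT.
  - by move=> z; have /andP[-> /le_trans] := rk z; apply; rewrite le_max lexx.
  move=> z; rewrite subr_le0 ler_pM2l // ler_expR mul0r subr0.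
  have /andP[V0 _] := V01 z; have := mulr_ge0 beta0 V0.
  by move: lc; lra.
rewrite mul0r subr_le0 /ratio -expRB addrK intrD mulrDr mulr1 [X in expR X]addrC addKr.
have f0 : forall y, 0 < f y by case: Df.
by rewrite ler_pdivlMr // expRN ler_pdivrMl ?expR_gt0.
Qed.


(** Each site with [V >= 1/2] raises the ratio above [expR (- c)] by a fixed factor. [F] counts
    these sites and [p] is their density, so the rate falls below [c] by a positive multiple of
    [p]. *)
Lemma decaying_solution_strict (F : int -> R) (p : R) : lam = ln (cosh c) -> 0 < beta ->
  0 < p -> slope F p ->
  (forall x, F (x + 1) - F x = (2^-1 <= V (x + 1))%R%:R) -> g < c.
Proof.
move=> lamE b0 p0 sF FE; have ch0 : 0 < cosh c by apply: lt_le_trans (cosh_ge1 c).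
have fle : forall y, f y <= expR c * f (y + 1).
  by apply: decaying_solution_le_expR; rewrite lamE.
have [rk rE rl] := ratioP _ _ _ _ _ Df.
have rge y : expR (- c) <= ratio f y.
  have := fle (y - 1); rewrite subrK /ratio => H.
  have f0 : forall y, 0 < f y by case: Df.
  by rewrite ler_pdivlMr // expRN ler_pdivrMl ?expR_gt0.
(* Without potential the recursion would give [2 * cosh c - expR (- c) = expR c]; the factor
   [expR (- (beta / 2))] makes [s] strictly smaller. *)
set s := 2 * cosh c * expR (- (beta / 2)) - expR (- c).
have sc : s < expR c.
  have : expR (- (beta / 2)) < 1 by rewrite expR_lt1 oppr_lt0 divr_gt0.
  rewrite -(ltr_pM2l ch0) mulr1 /s.
  have : 2 * cosh c = expR c + expR (- c) by rewrite /cosh; field.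
  by lra.
have rs y : 2^-1 <= V y -> (ratio f y)^-1 <= s.
  move=> Vy; have := rE y; have := rge (y + 1).
  have : expR (lam - beta * V y) <= cosh c * expR (- (beta / 2)).
    rewrite expRD lamE lnK ?posrE // ler_pM2l // ler_expR lerN2.
    by rewrite ler_pM2l.
  by rewrite /s; lra.
(* The sign of [s] is not known here; the maximum with [expR c / 2] keeps the argument of [ln]
   positive and still below [expR c]. *)
have s0 : 0 < c - ln (Num.max s (expR c / 2)).
  rewrite subr_gt0 -ltr_expR lnK; last by rewrite posrE lt_max divr_gt0 ?orbT ?expR_gt0.
  by rewrite gt_max sc /=; have := expR_gt0 c; lra.
set e := c - _ in s0.
have sG := slopeD _ _ _ _ (slope_linear (- c)) (slopeZ _ _ e sF).
have : - c + e * p <= - g.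
  case: Df => _ _ _ sf; apply: slope_le_incr sG sf _ => y.
  rewrite rl intrD.
  have FE' : F (y + 1) = F y + (2^-1 <= V (y + 1))%R%:R by rewrite -FE; ring.
  suff : - c + e * (2^-1 <= V (y + 1))%R%:R <= ln (ratio f (y + 1)).
    by rewrite FE'; lra.
  have /andP[r0 _] := rk (y + 1).
  have [Vy|_] := boolP (2^-1 <= V (y + 1)); last first.
    by rewrite mulr0 addr0 -ler_expR lnK ?posrE.
  rewrite mulr1 /e addKr lerNl -lnV ?posrE // ler_ln ?posrE ?invr_gt0 //.
    by rewrite le_max rs.
  by rewrite lt_max divr_gt0 ?orbT ?expR_gt0.
have := mulr_gt0 s0 p0; lra.
Qed.

(** Along a valley the recursion is close to the free one for [N] steps. The term in [h] is the
    accumulated effect of the potential, the last term the influence of the sites beyond. *)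
Lemma ratio_valley h N y : lam = ln (cosh c) -> 0 <= h ->
  (forall i : nat, (i < N)%N -> V (y + i%:Z) <= h) ->
  ratio f y <= expR (- c) + 2 * cosh c * beta * h / (1 - expR (beta - lam))
    + expR (beta - lam) ^+ N.
Proof.
move=> lamE h0 Vh; have b0 := beta0; have ch0 : 0 < cosh c by apply: lt_le_trans (cosh_ge1 c).
have Dc := decaying_solution_free V c c0.
have [rk rE _] := ratioP _ _ _ _ _ Df.
have [ck cE _] := ratioP _ _ _ _ _ Dc.
have k1 : expR (beta - lam) < 1 by rewrite expR_lt1 subr_lt0.
have D0 : 0 <= 2 * cosh c * beta * h by rewrite !mulr_ge0 // ltW.
have := ratio_cmp_trunc _ _ _ _ _ _ k1 D0 rk _ rE cE N y.
have -> : ratio (fun y => expR (- c * y%:~R)) y = expR (- c).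
  by rewrite /ratio -expRB; congr expR; rewrite intrB; ring.
suff H : forall i : nat, (i < N)%N -> 2 * expR (ln (cosh c) - 0 * V (y + i%:Z)) -
    2 * expR (lam - beta * V (y + i%:Z)) <= 2 * cosh c * beta * h.
  move=> /(_ _ H); rewrite lerBlDl addrA; apply => z.
  have /andP[-> /le_trans] := ck z; apply; rewrite ler_expR -lamE; lra.
move=> i iN; rewrite mul0r subr0 lnK ?posrE // lamE expRD lnK ?posrE //.
have := expR_ge1Dx (- (beta * V (y + i%:Z))).
set E := expR _; set v := V _ => HE.
have vh : beta * v <= beta * h by rewrite ler_wpM2l // Vh.
have -> : 2 * cosh c - 2 * (cosh c * E) = 2 * cosh c * (1 - E) by ring.
have Eh : 1 - E <= beta * h by lra.
by rewrite -[leRHS]mulrA ler_wpM2l // mulr_ge0 // ltW.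
Qed.

End below_free_rate.

Lemma exists_exprn_le k (e : R) : 0 <= k < 1 -> 0 < e -> exists N, k ^+ N <= e.
Proof.
move=> /andP[k0 k1] e0; have kn : `|k| < 1 by rewrite ger0_norm.
have /cvgrPdist_le /(_ e e0) [N _ /(_ N (leqnn N)) /=] := cvg_expr kn.
by rewrite sub0r normrN normrX (ger0_norm k0) => kN; exists N.
Qed.

(** Next to a valley the nondecreasing function [expR (c * y) * f y] is almost flat, so two such
    functions can be glued there at small cost. [h] and [N] are chosen before the potential and
    hence serve its reflection too. *)
Lemma valley_growth (beta c eta : R) : 0 < c -> 0 <= beta -> beta < ln (cosh c) -> 0 < eta ->
  exists h N, 0 < h < 1 /\ forall V g f y,
    decaying_solution V beta (ln (cosh c)) g f ->
    (forall i : nat, (i < N)%N -> V (y + 1 + i%:Z) <= h) ->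
    expR c * f (y + 1) <= expR eta * f y.
Proof.
move=> c0 b0 bl eta0; have ch0 : 0 < cosh c by apply: lt_le_trans (cosh_ge1 c).
(* Chosen so that [expR c * (expR (- c) + e) = expR eta]; one half of [e] is spent on [h], the other
   on the truncation at [N]. *)
set e := (expR eta - 1) * expR (- c).
have e0 : 0 < e by rewrite mulr_gt0 ?expR_gt0 // subr_gt0 expR_gt1.
have k1 : 0 < 1 - expR (beta - ln (cosh c)) by rewrite subr_gt0 expR_lt1 subr_lt0.
set K := 2 * cosh c * beta / (1 - expR (beta - ln (cosh c))).
have K0 : 0 <= K by rewrite divr_ge0 ?mulr_ge0 // ltW.
have e20 : 0 < e / 2 by rewrite divr_gt0.
have [|N HN] := exists_exprn_le (expR (beta - ln (cosh c))) (e / 2) _ e20.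
  by rewrite expR_ge0 expR_lt1 subr_lt0.
pose h : R := Num.min 2^-1 (e / 2 / (K + 1)).
have hK : K * h <= e / 2.
  apply: (@le_trans _ _ (K * (e / 2 / (K + 1)))).
    by rewrite ler_wpM2l // ge_min lexx orbT.
  rewrite mulrA ler_pdivrMr; last by lra.
  by rewrite mulrC ler_wpM2l ?(ltW e20) //; lra.
have h0 : 0 < h by rewrite lt_min divr_gt0 ?andbT //; lra.
have h1 : h < 1 by rewrite gt_min; apply/orP; left; lra.
exists h, N; rewrite h0 h1; split => // V g f y Df VN.
have f0 : forall y, 0 < f y by case: Df.
have := ratio_valley _ _ _ _ _ _ c0 b0 bl Df h N (y + 1) erefl (ltW h0) VN.
have -> : 2 * cosh c * beta * h / (1 - expR (beta - ln (cosh c))) = K * h.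
  by rewrite /K; field; rewrite gt_eqF.
rewrite /ratio addrK => Hr.
have {}Hr : f (y + 1) / f y <= expR (- c) + e by lra.
move: Hr; rewrite ler_pdivrMr // -(ler_pM2l (expR_gt0 c)) => /le_trans; apply.
rewrite mulrA ler_pM2r // /e expRN; have := expR_gt0 c => ec.
by rewrite (_ : expR c * _ = expR eta) //; field; rewrite gt_eqF.
Qed.

(* The Wronskian of the decaying and of the growing solution is constant and comparable
   to their product, so the product stays bounded. *)
Lemma wronskian V beta lam g f g' f' : beta < lam ->
  decaying_solution V beta lam g f -> decaying_solution (V \o -%R) beta lam g' f' ->
  g' <= g.
Proof.
move=> bl [f0 fk fE sf] [f'0 f'k f'E sf'].
pose k x := f' (- x); pose W x := f (x - 1) * k x - f x * k (x - 1).
have kE y : expR (beta * V y) * (k (y + 1) + k (y - 1)) = 2 * expR lam * k y.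
  have := f'E (- y); rewrite /= opprK /k addrC => <-.
  by congr (_ * (f' _ + f' _)); ring.
have WS y : W (y + 1) = W y.
  have e0 : expR (beta * V y) != 0 by rewrite gt_eqF ?expR_gt0.
  move: (kE y) (fE y); rewrite /W addrK.
  move: (k y) (k (y + 1)) (k (y - 1)) => a b b' kk ff.
  apply: (mulfI e0).
  have -> : expR (beta * V y) * (f y * b - f (y + 1) * a) =
      f y * (expR (beta * V y) * (b + b')) - a * (expR (beta * V y) * (f (y + 1) + f (y - 1)))
      + expR (beta * V y) * (f (y - 1) * a - f y * b') by ring.
  by rewrite kk ff; ring.
have W0 (n : nat) : W n%:Z = W 0.
  by elim: n => [//|n <-]; rewrite -addn1 PoszD WS.
set q := expR (beta - lam) in fk f'k.
have q0 : 0 < q by rewrite expR_gt0.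
have q1 : q < 1 by rewrite expR_lt1 subr_lt0.
have fkW y : f y * k y * (q^-1 - q) <= W y.
  have H1 : f y <= q * f (y - 1) by have := fk (y - 1); rewrite subrK.
  have H2 : k (y - 1) <= q * k y by have := f'k (- y); rewrite /k opprB addrC.
  have H3 : f y * q^-1 * k y <= f (y - 1) * k y.
    by rewrite ler_pM2r ?f'0 // ler_pdivrMr // mulrC.
  have H4 : f y * k (y - 1) <= f y * (q * k y) by rewrite ler_pM2l.
  by rewrite /W; lra.
have qq : 0 < q^-1 - q.
  by rewrite subr_gt0 (lt_trans q1) // invf_gt1.
have sk : slope (fun y => ln (k y)) g'.
  by have := slope_opp _ _ sf'; rewrite opprK.
suff : - g <= -1 * g' by lra.
apply: (slope_le _ _ _ _ (ln (W 0 / (q^-1 - q))) sf (slopeZ _ _ (-1) sk)) => n.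
have fk0 : 0 < f n%:Z * k n%:Z by rewrite mulr_gt0 // f'0.
have : ln (f n%:Z * k n%:Z) <= ln (W 0 / (q^-1 - q)).
  have fkn : f n%:Z * k n%:Z <= W 0 / (q^-1 - q) by rewrite ler_pdivlMr // -(W0 n).
  by rewrite ler_ln ?posrE // (lt_le_trans fk0).
by rewrite lnM ?posrE ?f'0 //; lra.
Qed.

Lemma decaying_solution_opp_rate V beta lam g f g' f' : beta < lam ->
  decaying_solution V beta lam g f -> decaying_solution (V \o -%R) beta lam g' f' ->
  g = g'.
Proof.
move=> bl Df Df'; apply/le_anti/andP; split; last exact: wronskian Df Df'.
apply: wronskian Df' _ => //; rewrite -compA (_ : -%R \o -%R = id); first exact: Df.
by apply/funext => x /=; rewrite opprK.
Qed.

End decaying_solutions.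

(** * Sub- and supersolutions of the control problem *)

Section growth_constructions.
Context {R : realType}.
Implicit Types (V f G : int -> R) (beta delta lam mu theta eta c g h s : R) (x y a : int).

(** The distance from [x] to the nearest point of [Q] is sublinear in [|x|]; gaps need not be
    bounded. *)
Definition recurrent (Q : int -> Prop) := forall eta : R, 0 < eta ->
  exists C : R, forall x, exists a, `|a%:~R - x%:~R| <= eta * `|x%:~R| + C /\ Q a.

(** The second solution, reflected back, is the growing solution of the equation for [V]. *)
Definition good_potential V beta lam g :=
  (exists f, decaying_solution V beta lam g f) /\
  (exists f, decaying_solution (V \o -%R) beta lam g f).

(* The extreme controls (1 +- delta) / 2 are the exponential tilts exp(+- c) / (2 cosh c). *)
Definition tilt delta c := (1 + delta) * cosh c = expR c /\ (1 - delta) * cosh c = expR (- c).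

Lemma cosh_gt0 c : 0 < cosh c.
Proof. exact: lt_le_trans (cosh_ge1 c). Qed.

Lemma tilt_mean delta c A B : tilt delta c ->
  (1 - delta) / 2 * (expR c * A) + (1 + delta) / 2 * (expR (- c) * B)
  = (A + B) / (2 * cosh c).
Proof.
move=> [tp tm]; have ch := lt0r_neq0 (cosh_gt0 c).
have ec := expR_gt0 c; have em := expR_gt0 (- c).
have -> : (1 - delta) / 2 = expR (- c) / (2 * cosh c) by rewrite -tm; field.
have -> : (1 + delta) / 2 = expR c / (2 * cosh c) by rewrite -tp; field.
by rewrite expRN; field; rewrite ch gt_eqF.
Qed.

(* On an increasing function the best control is the extreme drift to the left, which
   turns the control problem into the linear one. *)
Lemma lower_growth_increasing V beta1 beta delta c lam s f :
  (forall y, 0 <= V y) -> 0 <= delta <= 1 -> tilt delta c -> beta1 <= beta ->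
  (forall y, 0 < f y) -> (forall y, f y <= expR c * f (y + 1)) ->
  (forall y, expR (beta1 * V y) * (f (y + 1) + f (y - 1)) = 2 * expR lam * f y) ->
  slope (fun y => ln (f y)) s ->
  lower_growth V beta delta (lam - ln (cosh c)) (c + s).
Proof.
move=> V0 /andP[d0 d1] tc b1 f0 fi fE sf eta eta0.
have [C HC] := sf eta eta0; exists C => x; exists (fun y => expR (c * y%:~R) * f y).
have ch := cosh_gt0 c.
split=> [y q|y|].
- rewrite ler_norml => /andP[q1 q2]; set Ey := expR (c * y%:~R).
  have Ey0 : 0 < Ey := expR_gt0 _.
  have -> : expR (c * (y + 1)%:~R) = Ey * expR c by rewrite -expRD intrD mulrDr mulr1.
  have -> : expR (c * (y - 1)%:~R) = Ey * expR (- c).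
    by rewrite -expRD intrB mulrBr mulr1.
  have inc : expR (- c) * f (y - 1) <= expR c * f (y + 1).
    have := fi (y - 1); rewrite subrK -(ler_pM2l (expR_gt0 (- c))) mulrA -expRD addNr expR0 mul1r.
    by move=> /le_trans; apply; apply: fi.
  have H : (f (y + 1) + f (y - 1)) / (2 * cosh c)
      <= q * (expR c * f (y + 1)) + (1 - q) * (expR (- c) * f (y - 1)).
    rewrite -(tilt_mean _ _ _ _ tc) -subr_ge0.
    set A := expR c * _ in inc *; set B := expR (- c) * _ in inc *.
    have -> : q * A + (1 - q) * B - ((1 - delta) / 2 * A + (1 + delta) / 2 * B)
      = (q - (1 - delta) / 2) * (A - B) by field.
    by rewrite mulr_ge0 ?subr_ge0 //; lra.
  have -> : q * (Ey * expR c * f (y + 1)) + (1 - q) * (Ey * expR (- c) * f (y - 1))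
     = Ey * (q * (expR c * f (y + 1)) + (1 - q) * (expR (- c) * f (y - 1))) by ring.
  apply: (@le_trans _ _ (expR (beta * V y) * (Ey * ((f (y + 1) + f (y - 1)) / (2 * cosh c)))));
    last first.
    by rewrite ler_pM2l ?expR_gt0 // ler_pM2l.
  (* As [V >= 0], raising [beta1] to [beta] only increases the right-hand side, so solutions for a
     weaker potential remain subsolutions. *)
  apply: (@le_trans _ _ (expR (beta1 * V y) * (Ey * ((f (y + 1)
    + f (y - 1)) / (2 * cosh c))))); last first.
    apply: ler_wpM2r; last by rewrite ler_expR ler_wpM2r.
    by rewrite !mulr_ge0 ?invr_ge0 ?addr_ge0 ?mulr_ge0 // ltW.
  have -> : expR (beta1 * V y) * (Ey * ((f (y + 1) + f (y - 1)) / (2 * cosh c)))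
    = Ey * (expR (beta1 * V y) * (f (y + 1) + f (y - 1))) / (2 * cosh c).
    by field; rewrite gt_eqF.
  rewrite fE (_ : Ey * (2 * expR lam * f y) / (2 * cosh c) = expR lam / cosh c * (Ey * f y)).
    apply: ler_wpM2r; first by rewrite mulr_ge0 // ltW.
    by rewrite -{2}[cosh c]lnK ?posrE // -expRB ler_expR; lra.
  by field; rewrite gt_eqF.
- have := HC y; rewrite ler_norml => /andP[_ Hy].
  rewrite -[f y]lnK ?posrE // -expRD ler_expR.
  by have := mulr_ge0 (ltW eta0) (normr_ge0 (x%:~R : R)); lra.
- have := HC x; rewrite ler_norml => /andP[Hy _].
  by rewrite -[f x]lnK ?posrE // -expRD ler_expR; lra.
Qed.

(** An upper bound needs one admissible control, here the extreme drift to the left at every site.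
    The factor [expR (c * y)] turns it into the fair coin and divides the eigenvalue by [cosh c]. *)
Lemma upper_growth_tilt V beta delta c lam theta :
  0 <= delta <= 1 -> tilt delta c ->
  upper_growth V beta 0 lam (theta - c) ->
  upper_growth V beta delta (lam - ln (cosh c)) theta.
Proof.
move=> /andP[d0 d1] tc H eta eta0; have [C HC] := H eta eta0; exists C => x.
have [G [superG Gge Gx]] := HC x; exists (fun y => expR (c * y%:~R) * G y).
have ch := cosh_gt0 c.
split=> [y|y|].
- exists ((1 - delta) / 2).
    by rewrite (_ : 2 * _ - 1 = - delta) ?normrN ?ger0_norm //; field.
  set Ey := expR (c * y%:~R).
  have Ey0 : 0 < Ey := expR_gt0 _.
  have -> : expR (c * (y + 1)%:~R) = Ey * expR c by rewrite -expRD intrD mulrDr mulr1.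
  have -> : expR (c * (y - 1)%:~R) = Ey * expR (- c).
    by rewrite -expRD intrB mulrBr mulr1.
  have -> : (1 - delta) / 2 * (Ey * expR c * G (y + 1)) +
      (1 - (1 - delta) / 2) * (Ey * expR (- c) * G (y - 1))
    = Ey * ((1 - delta) / 2 * (expR c * G (y + 1)) + (1 + delta) / 2 * (expR (- c) * G (y - 1))).
    by field.
  rewrite (tilt_mean _ _ _ _ tc).
  have [q] := superG y; rewrite normr_le0 subr_eq0 => /eqP q2.
  have -> : q = 2^-1 by lra.
  move=> Hq.
  rewrite (_ : expR (beta * V y) * _ = Ey / cosh c * (expR (beta * V y) * (2^-1 * G (y + 1)
    + (1 - 2^-1) * G (y - 1)))).
    apply: (le_trans (ler_wpM2l _ Hq)); first by rewrite divr_ge0 // ltW.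
    rewrite [lam - _ + _]addrAC expRB lnK ?posrE // le_eqVlt; apply/orP; left; apply/eqP.
    by field; rewrite gt_eqF.
  by field; rewrite gt_eqF.
- apply: le_trans (ler_wpM2l (expR_ge0 _) (Gge y)); rewrite -expRD ler_expR; lra.
- apply: le_trans (ler_wpM2l (expR_ge0 _) Gx) _; rewrite -expRD ler_expR; lra.
Qed.

Lemma upper_growth_limit V beta delta mu theta :
  (forall e, 0 < e -> upper_growth V beta delta (mu + e) theta) ->
  upper_growth V beta delta mu theta.
Proof.
move=> H eta eta0; have e0 : 0 < eta / 2 by rewrite divr_gt0.
have [C HC] := H _ e0 _ e0; exists C => x; have [G [superG Gge Gx]] := HC x.
have x0 := mulr_ge0 (ltW eta0) (normr_ge0 (x%:~R : R)).
exists G; split.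
- by move: superG; rewrite -addrA -splitr.
- move=> y; apply: le_trans (Gge y); rewrite ler_expR.
  by have := mulr_ge0 (ltW eta0) (normr_ge0 (y%:~R : R)); lra.
- by apply: le_trans Gx _; rewrite ler_expR; lra.
Qed.

(** The sum of the decaying and the growing solution, normalised at the start [x], lies above
    [expR (theta * y)] up to the allowed error: the decaying one suffices to the left of [x], the
    growing one to the right. One [lam] thus serves a whole interval of tilts. *)
Lemma upper_growth_free V beta lam g theta :
  good_potential V beta lam g -> `|theta| <= g -> upper_growth V beta 0 lam theta.
Proof.
move=> [[f [f0 _ fE sf]] [k [k0 _ kE sk]]] tg eta eta0.
move: tg; rewrite ler_norml => /andP[tg1 tg2].
have e0 : 0 < eta / 2 by rewrite divr_gt0.
have [C1 C10 H1] := slope_ge0_bound _ _ _ sf e0.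
have [C2 C20 H2] := slope_ge0_bound _ _ _ (slope_opp _ _ sk) e0.
(* The final [1] absorbs the value [1 + 1] that the normalised sum takes at [x]. *)
exists (2 * C1 + 2 * C2 + 1) => x.
exists (fun y => expR (theta * x%:~R) * (f y / f x + k (- y) / k (- x))).
have fx := f0 x; have kx := k0 (- x).
have x0 := mulr_ge0 (ltW eta0) (normr_ge0 (x%:~R : R)).
have {}H1 y : `|ln (f y) + g * y%:~R| <= eta / 2 * `|y%:~R| + C1.
  by have := H1 y; rewrite mulNr opprK.
have {}H2 y : `|ln (k (- y)) - g * y%:~R| <= eta / 2 * `|y%:~R| + C2.
  by have := H2 y; rewrite opprK.
split=> [y|y|].
- exists 2^-1; first by rewrite mulfV ?subrr ?normr0.
  have kE' : expR (beta * V y) * (k (- (y + 1)) + k (- (y - 1))) = 2 * expR lam * k (- y).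
    have := kE (- y); rewrite /= opprK => <-.
    by rewrite addrC; congr (_ * (k _ + k _)); ring.
  have -> : expR (beta * V y) *
    (2^-1 * (expR (theta * x%:~R) * (f (y + 1) / f x + k (- (y + 1)) / k (- x))) +
    (1 - 2^-1) * (expR (theta * x%:~R) * (f (y - 1) / f x + k (- (y - 1)) / k (- x))))
    = 2^-1 * expR (theta * x%:~R) * (expR (beta * V y) * (f (y + 1) + f (y - 1)) / f x
    + expR (beta * V y) * (k (- (y + 1)) + k (- (y - 1))) / k (- x)).
    by field; rewrite !gt_eqF.
  rewrite fE kE'.
  have -> : 2^-1 * expR (theta * x%:~R) * (2 * expR lam * f y / f x
    + 2 * expR lam * k (- y) / k (- x))
    = expR lam * (expR (theta * x%:~R) * (f y / f x + k (- y) / k (- x))).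
    by field; rewrite !gt_eqF.
  apply: ler_wpM2r; last by rewrite ler_expR; lra.
  by rewrite mulr_ge0 ?expR_ge0 // addr_ge0 // divr_ge0 // ltW.
- have y0 := mulr_ge0 (ltW eta0) (normr_ge0 (y%:~R : R)).
  rewrite [leRHS]mulrDr.
  have -> : f y / f x = expR (ln (f y) - ln (f x)) by rewrite expRB !lnK ?posrE.
  have -> : k (- y) / k (- x) = expR (ln (k (- y)) - ln (k (- x))) by rewrite expRB !lnK ?posrE.
  rewrite -!expRD.
  have := H1 x; have := H1 y; have := H2 x; have := H2 y.
  rewrite !ler_norml => /andP[? ?] /andP[? ?] /andP[? ?] /andP[? ?].
  have [yx|xy] := leP y x.
    have : (theta + g) * (y%:~R - x%:~R) <= 0.
      by rewrite mulr_ge0_le0 ?subr_le0 ?ler_int //; lra.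
    move=> ?; apply: ler_wpDr; first exact: expR_ge0.
    by rewrite ler_expR; lra.
  have : 0 <= (g - theta) * (y%:~R - x%:~R).
    by rewrite mulr_ge0 ?subr_ge0 ?ler_int ?(ltW xy) //; lra.
  move=> ?; apply: ler_wpDl; first exact: expR_ge0.
  by rewrite ler_expR; lra.
- rewrite !divff ?gt_eqF // -[1 + 1]lnK ?posrE // -expRD ler_expR.
  have : ln (1 + 1) <= 1 :> R by rewrite -ler_expR lnK ?posrE // expR_ge1Dx.
  lra.
Qed.

Lemma subsolutionZ V beta delta mu r G : 0 <= r ->
  subsolution V beta delta mu G -> subsolution V beta delta mu (fun y => r * G y).
Proof.
move=> r0 H y q hq; move: (ler_wpM2l r0 (H y q hq)); congr (is_true (_ <= _)); ring.
Qed.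

Lemma ltz_neighbours (y a : int) : y < a -> y + 1 <= a /\ y - 1 <= a /\ y <= a.
Proof. lia. Qed.

Lemma gtz_neighbours (y a : int) : a < y -> a <= y + 1 /\ a <= y - 1 /\ a <= y.
Proof. lia. Qed.

Lemma dist_right (a : int) (i : nat) : `|a + 1 + i%:Z - a| = i.+1%:Z.
Proof. lia. Qed.

Lemma dist_left (a : int) (i : nat) : `|- (- a + 1 + i%:Z) - a| = i.+1%:Z.
Proof. lia. Qed.

Lemma absz_neighbours (z : int) (j : nat) : absz z = j.+1 ->
  (absz (z + 1) = j.+2 /\ absz (z - 1) = j) \/ (absz (z + 1) = j /\ absz (z - 1) = j.+2).
Proof. lia. Qed.

(** Reflection about [a] exchanges [q] and [1 - q], so one side of [a] is enough; at [a] both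
    neighbours have the value [psi 1] and the control has no effect. *)
Lemma radial_subsolution V beta delta mu a (psi : nat -> R) :
  expR mu * psi 0%N <= expR (beta * V a) * psi 1%N ->
  (forall y j, absz (y - a)%R = j.+1 -> forall q : R, `|2 * q - 1| <= delta ->
     expR mu * psi j.+1 <= expR (beta * V y) * (q * psi j.+2 + (1 - q) * psi j)) ->
  subsolution V beta delta mu (fun y => psi (absz (y - a)%R)).
Proof.
move=> H0 H1 y q hq; rewrite -!(addrAC y (- a)).
case jE : (absz (y - a)%R) => [|j].
  move/eqP: jE; rewrite absz_eq0 subr_eq0 => /eqP ->; rewrite subrr sub0r add0r.
  by rewrite -mulrDl addrC subrK mul1r.
have [[-> ->]|[-> ->]] := absz_neighbours _ _ jE; first exact: H1.
have := H1 y j jE (1 - q).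
rewrite (_ : 2 * (1 - q) - 1 = - (2 * q - 1)) ?normrN; last by ring.
by move=> /(_ hq); congr (is_true (_ <= _ * _)); ring.
Qed.

(** * A radial profile supported on a hill *)

Section hill_profile.
Variables (delta c : R) (L : nat).

(** The factor [expR (- c * j)] makes outward drift the worst case and turns it into plain averaging
    of the remaining quadratic, whose second difference is the constant [- 2 * delta], small against
    its values for large [L]. The factor [1 + delta * j] fits the centre: as
    [(1 + delta) * cosh c = expR c], the value at [1] is [(L - 1) / cosh c], against [L] at [0]. The
    factor [L - j] lets the profile end at distance [L]. *)
Definition hill_profile (j : nat) : R :=
  if (j <= L)%N then expR (- c * j%:R) * ((1 + delta * j%:R) * (L%:R - j%:R)) else 0.

Hypotheses (d0 : 0 <= delta) (d1 : delta <= 1) (c0 : 0 <= c) (tc : tilt delta c).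
Variable e : R.
Hypothesis eL : 1 <= e * (L%:R - 1).

Lemma hill_profile_ge0 j : 0 <= hill_profile j.
Proof.
rewrite /hill_profile; case: ifP => // jL.
apply: mulr_ge0; first exact: expR_ge0.
by apply: mulr_ge0; [rewrite addr_ge0 ?mulr_ge0 | rewrite subr_ge0 ler_nat].
Qed.

Lemma hill_profile_out j : (L <= j)%N -> hill_profile j = 0.
Proof.
rewrite leq_eqVlt => /predU1P[<-|jL]; rewrite /hill_profile.
  by rewrite leqnn subrr !mulr0.
by rewrite leqNgt jL.
Qed.

Lemma hill_profile_le j : hill_profile j <= expR (2 * L%:R).
Proof.
rewrite /hill_profile; case: ifP => jL; last exact: expR_ge0.
have j0 : 0 <= j%:R :> R by [].
have jL' : j%:R <= L%:R :> R by rewrite ler_nat.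
have E1 : expR (- c * j%:R) <= 1.
  by rewrite -expR0 ler_expR mulNr oppr_le0 mulr_ge0.
have E2 : 1 + delta * j%:R <= expR L%:R.
  apply: le_trans (expR_ge1Dx _); rewrite lerD2l; apply: le_trans jL'.
  by rewrite ler_piMl.
have E3 : L%:R - j%:R <= expR L%:R :> R.
  by apply: le_trans (expR_ge1Dx _); lra.
have P2 : 0 <= 1 + delta * j%:R by rewrite addr_ge0 ?mulr_ge0.
have P3 : 0 <= L%:R - j%:R :> R by rewrite subr_ge0.
rewrite -[leRHS]mul1r mulr_natl mulr2n expRD.
by apply: ler_pM => //; rewrite ?expR_ge0 ?mulr_ge0 //; apply: ler_pM.
Qed.

Lemma hill_profile_center : (0 < L)%N ->
  (1 - e) / cosh c * hill_profile 0 <= hill_profile 1.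
Proof.
move=> L0; have ch := cosh_gt0 c; rewrite /hill_profile L0 /= mulr0 expR0 mul1r.
rewrite mulr0 addr0 mul1r subr0 mulr1 mulr1 expRN.
have [tp _] := tc; rewrite -tp.
have d1' : 0 < 1 + delta by have := d0; lra.
have -> : ((1 + delta) * cosh c)^-1 * ((1 + delta) * (L%:R - 1)) = (L%:R - 1) / cosh c.
  by field; rewrite !gt_eqF.
rewrite mulrAC ler_pM2r ?invr_gt0 //.
have L1 : 1 <= L%:R :> R by rewrite ler1n.
have e0 : 0 <= e.
  rewrite leNgt; apply/negP => e0; have := eL.
  have : e * (L%:R - 1) <= 0 by rewrite nmulr_rle0 // subr_ge0.
  lra.
by have := eL; lra.
Qed.

Lemma hill_profile_mean j (q : R) : (j.+1 < L)%N -> `|2 * q - 1| <= delta ->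
  (1 - e) / cosh c * hill_profile j.+1
  <= q * hill_profile j.+2 + (1 - q) * hill_profile j.
Proof.
move=> jL; rewrite ler_norml => /andP[q1 q2]; have ch := cosh_gt0 c.
rewrite /hill_profile jL (ltnW jL) (ltnW (ltnW jL)).
set J : R := j%:R; have J0 : 0 <= J by [].
have -> : j.+2%:R = J + 2 by rewrite -addn2 natrD.
have -> : j.+1%:R = J + 1 by rewrite -addn1 natrD.
have JL : J + 2 <= L%:R by rewrite -natrD ler_nat addn2.
have -> : expR (- c * (J + 2)) = expR (- c * (J + 1)) * expR (- c).
  by rewrite -expRD; congr expR; ring.
have -> : expR (- c * J) = expR (- c * (J + 1)) * expR c.
  by rewrite -expRD; congr expR; ring.
set E := expR (- c * (J + 1)); have E0 : 0 < E := expR_gt0 _.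
have el := eL; set l : R := L%:R in JL el *.
set f0 := (1 + delta * J) * (l - J).
set f1 := (1 + delta * (J + 1)) * (l - (J + 1)).
set f2 := (1 + delta * (J + 2)) * (l - (J + 2)).
have [tp tm] := tc; have dd0 := d0; have dd1 := d1.
have f20 : expR (- c) * f2 <= expR c * f0.
  rewrite -tp -tm !(mulrAC _ (cosh c)) ler_pM2r //.
  have : 0 <= (l - (J + 2)) * ((1 + delta) * (1 + delta * J) - (1 - delta) * (1 + delta * (J + 2))).
    rewrite mulr_ge0 ?subr_ge0 // -subr_ge0 (_ : _ - _ = 2 * delta ^+ 2 * (J + 1)); last by ring.
    by rewrite !mulr_ge0 ?sqr_ge0 //; lra.
  have : 0 <= 2 * (1 + delta) * (1 + delta * J).
    by rewrite !mulr_ge0 ?addr_ge0 ?mulr_ge0.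
  by rewrite /f0 /f2; lra.
have f1e : delta <= e * f1.
  have Hf : delta * (l - 1) <= f1.
    rewrite -subr_ge0 (_ : _ - _ = (1 - delta) * (l - (J + 1)) + delta * ((J + 1) * (l - (J
      + 2)) + 1)); last by rewrite /f1; ring.
    by rewrite addr_ge0 // mulr_ge0 ?subr_ge0 ?addr_ge0 ?mulr_ge0 ?subr_ge0 //; lra.
  have l1 : 0 < l - 1 by lra.
  have e0 : 0 <= e.
    rewrite -(pmulr_lge0 _ l1); lra.
  apply: le_trans (ler_wpM2l e0 Hf); rewrite mulrCA -[leLHS]mulr1.
  by rewrite ler_wpM2l.
have mean := tilt_mean _ _ f0 f2 tc.
have -> : q * (E * expR (- c) * f2) + (1 - q) * (E * expR c * f0)
   = E * (((1 + delta) / 2 - q) * (expR c * f0 - expR (- c) * f2)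
     + ((1 - delta) / 2 * (expR c * f0) + (1 + delta) / 2 * (expR (- c) * f2))) by field.
rewrite mean (_ : (1 - e) / cosh c * (E * f1) = E * ((f1 - e * f1) / cosh c));
  last by field; rewrite gt_eqF.
rewrite ler_pM2l // (_ : f0 + f2 = 2 * (f1 - delta)); last by rewrite /f0 /f1 /f2; ring.
rewrite (_ : 2 * (f1 - delta) / (2 * cosh c) = (f1 - delta) / cosh c);
  last by field; rewrite gt_eqF.
apply: ler_wpDl.
  by rewrite mulr_ge0 ?subr_ge0 //; lra.
by rewrite ler_pM2r ?invr_gt0 //; lra.
Qed.

End hill_profile.

Lemma max_cases (u v : R) : Num.max u v = u \/ Num.max u v = v.
Proof. by case: leP; auto. Qed.

Lemma natr_absz_sub y a : (absz (y - a)%R)%:R = `|y%:~R - a%:~R| :> R.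
Proof. by rewrite natr_absz intr_norm intrB. Qed.

(* The travel term keeps the profile positive far away from the hill, where it is a
   subsolution because it decays fast. *)
Lemma hill_travel_subsolution V beta delta c (e h m B : R) (L : nat) a :
  (forall y, 0 <= V y) -> 0 <= beta -> 0 <= delta < 1 -> 0 <= c -> tilt delta c ->
  1 <= e * (L%:R - 1) -> (0 < L)%N -> 
  (forall y, `|y%:~R - a%:~R| <= L%:R :> R -> h <= V y) ->
  expR m <= expR (beta * h) * ((1 - e) / cosh c) -> 0 <= B ->
  expR (m - B) <= (1 - delta) / 2 ->
  subsolution V beta delta m (fun y =>
    Num.max (hill_profile delta c L (absz (y - a)%R)) (expR (- B * (absz (y - a)%R)%:R))).
Proof.
move=> V0 b0 /andP[d0 d1] c0 tc eL L0 Vh mh B0 mB.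
have phi0 := hill_profile_ge0 delta c L d0.
have eVh y : (absz (y - a)%R <= L)%N -> expR m <= expR (beta * V y) * ((1 - e) / cosh c).
  move=> yL; apply: le_trans (mh) _; apply: ler_wpM2r.
    rewrite -(pmulr_rge0 _ (expR_gt0 (beta * h))); exact: le_trans (expR_ge0 m) mh.
  by rewrite ler_expR ler_wpM2l // Vh // -natr_absz_sub ler_nat.
have V1 y : 1 <= expR (beta * V y) by rewrite -expR0 ler_expR mulr_ge0.
apply: (radial_subsolution V beta delta m a (fun j =>
  Num.max (hill_profile delta c L j) (expR (- B * j%:R)))).
  (* At the centre both neighbours are farther away, and the travel term need not be a subsolution
     there; the profile wins because its value [L] is at least [1]. *)
  have -> : Num.max (hill_profile delta c L 0) (expR (- B * 0%:R)) = hill_profile delta c L 0.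
    apply/max_l; rewrite mulr0 expR0 /hill_profile leq0n !mulr0 expR0 mul1r addr0 mul1r subr0.
    by rewrite ler1n.
  apply: le_trans (ler_wpM2r (phi0 _) (eVh a _)) _; first by rewrite subrr.
  rewrite -mulrA ler_wpM2l ?expR_ge0 //.
  apply: le_trans (hill_profile_center delta c L d0 tc e eL L0) _.
  by rewrite le_max lexx.
move=> y j jE q hq.
have /andP[q0 q1] : 0 <= q <= 1.
  by move: hq; rewrite ler_norml => /andP[? ?]; apply/andP; split; lra.
have q1d : (1 - delta) / 2 <= 1 - q.
  by move: hq; rewrite ler_norml => /andP[? ?]; lra.
have q10 : 0 <= 1 - q by rewrite subr_ge0.
set psi := fun j : nat => Num.max (hill_profile delta c L j) (expR (- B * j%:R)).
rewrite -[Num.max _ _]/(psi j.+1) -[X in q * X]/(psi j.+2) -[X in (1 - q) * X]/(psi j).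
have psiphi i : hill_profile delta c L i <= psi i by rewrite le_max lexx.
have psiB i : expR (- B * i%:R) <= psi i by rewrite le_max lexx orbT.
have [->|->] : psi j.+1 = hill_profile delta c L j.+1 \/ psi j.+1 = expR (- B * j.+1%:R).
  exact: max_cases.
  have psi0 i : 0 <= psi i := le_trans (phi0 i) (psiphi i).
  have [Lj|jL] := leqP L j.+1.
    rewrite hill_profile_out // mulr0.
    by rewrite mulr_ge0 ?expR_ge0 // addr_ge0 ?mulr_ge0.
  apply: le_trans (ler_wpM2r (phi0 _) (eVh y _)) _; first by rewrite jE ltnW.
  rewrite -mulrA ler_wpM2l ?expR_ge0 //.
  apply: le_trans (hill_profile_mean delta c L d0 (ltW d1) tc e eL j q jL hq) _.
  by apply: lerD; rewrite ler_wpM2l.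
(* The step towards the hill has probability at least [(1 - delta) / 2] and gains a factor [expR B],
   which beats [expR m] by the choice of [B]. *)
apply: (@le_trans _ _ ((1 - delta) / 2 * expR (- B * j%:R))).
  rewrite -natr1 mulrDr mulr1 expRD mulrCA mulrC ler_wpM2r ?expR_ge0 //.
  by rewrite -expRD.
apply: (@le_trans _ _ ((1 - q) * psi j)).
  by apply: ler_pM; rewrite ?expR_ge0 // divr_ge0 // subr_ge0 ltW.
have psi0 i : 0 <= psi i := le_trans (phi0 i) (psiphi i).
apply: (@le_trans _ _ (q * psi j.+2 + (1 - q) * psi j)).
  by rewrite lerDr mulr_ge0.
by rewrite ler_peMl // addr_ge0 ?mulr_ge0.
Qed.

Definition has_hills V := forall h (L : nat), h < 1 ->
  recurrent (fun a => forall y, `|y%:~R - a%:~R| <= L%:R :> R -> h <= V y).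

Definition has_valleys V := forall h (L : nat), 0 < h ->
  recurrent (fun a => forall y, `|y%:~R - a%:~R| <= L%:R :> R -> V y <= h).

(** One rate holds for every [theta]: the subsolution is weighted by [expR (theta * a)] at the
    centre [a] of a hill near [x], its profile has bounded support, and its travel term stays below
    [expR (theta * y)] because [B >= |theta|]. *)
Lemma lower_growth_hills V beta delta c theta :
  (forall y, 0 <= V y) -> 0 <= beta -> 0 <= delta < 1 -> 0 <= c -> tilt delta c ->
  has_hills V -> lower_growth V beta delta (beta - ln (cosh c)) theta.
Proof.
move=> V0 b0 d01 c0 tc hills eta eta0; have ch := cosh_gt0 c.
have /andP[d0 d1] := d01.
set m := beta - ln (cosh c) - eta.
(* The loss [eta] is shared equally by the profile, through [1 - e = expR (- (eta / 2))], and by the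
   height of the hill, through [beta * h >= beta - eta / 2]. *)
pose e : R := 1 - expR (- (eta / 2)).
have e0 : 0 < e by rewrite subr_gt0 expR_lt1 oppr_lt0 divr_gt0.
pose L := (Num.truncn e^-1).+2.
have eL : 1 <= e * (L%:R - 1).
  rewrite -ler_pdivrMl // mulr1 /L -natr1 addrK; exact: ltW (truncnS_gt _).
pose h : R := 1 - eta / (2 * (beta + 1)).
have b1 : 0 < 2 * (beta + 1) by lra.
have h1 : h < 1 by rewrite /h ltrBlDr ltrDl divr_gt0.
have bh : beta - eta / 2 <= beta * h.
  have -> : beta * h = beta - eta / 2 * (beta / (beta + 1)) by rewrite /h; field; lra.
  rewrite lerD2l lerN2 -[leRHS]mulr1 ler_wpM2l ?divr_ge0 ?(ltW eta0) // ler_pdivrMr; lra.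
have mh : expR m <= expR (beta * h) * ((1 - e) / cosh c).
  rewrite /e subKr mulrA ler_pdivlMr // -[cosh c]lnK ?posrE // -!expRD ler_expR /m.
  by move: bh; lra.
(* This is where [delta < 1] enters: for [delta = 1] the controller could keep the walk away from
   the hill. *)
have [B [Btheta mB]] : exists B : R, `|theta| <= B /\ expR (m - B) <= (1 - delta) / 2.
  have ln_d : ln ((1 - delta) / 2) <= 0 by rewrite ln_le0 //; lra.
  exists (`|m| + `|theta| - ln ((1 - delta) / 2)).
  split; first by have := normr_ge0 m; lra.
  rewrite -[leRHS]lnK ?ler_expR; last by rewrite posrE; lra.
  by have := ler_norm m; have := normr_ge0 theta; lra.
have B0 : 0 <= B := le_trans (normr_ge0 theta) Btheta.
have BT : 0 <= B + `|theta| by rewrite addr_ge0.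
have B1 : 0 < B + `|theta| + 1 by have := normr_ge0 theta; lra.
have [C2 HC2] := hills h L h1 _ (divr_gt0 eta0 B1).
exists (`|theta| * L%:R + 2 * L%:R + (B + `|theta|) * `|C2|) => x.
have [a [ax hill]] := HC2 x.
have sub := hill_travel_subsolution V beta delta c e h m B L a V0 b0 d01 c0 tc eL isT hill mh B0 mB.
have K0 : 0 <= (B + `|theta|) * `|C2| by rewrite mulr_ge0.
have L0 : 0 <= L%:R :> R by [].
have tL : 0 <= `|theta| * L%:R by rewrite mulr_ge0.
have theta_dist y z : theta * y%:~R <= theta * z%:~R + `|theta| * `|z%:~R - y%:~R|.
  rewrite -normrM; have := ler_norm (- (theta * (z%:~R - y%:~R))); rewrite normrN; lra.
eexists; split; first exact: subsolutionZ (expR_ge0 (theta * a%:~R)) sub.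
- move=> y /=; have yy : 0 <= eta * (`|x%:~R| + `|y%:~R|) by rewrite mulr_ge0 ?(ltW eta0) ?addr_ge0.
  have tya := theta_dist a y.
  have [->|->] := max_cases (hill_profile delta c L (absz (y - a)%R))
    (expR (- B * (absz (y - a)%R)%:R)).
  + have [jL|Lj] := leqP (absz (y - a)%R) L; last first.
      by rewrite hill_profile_out ?mulr0 ?expR_ge0 // ltnW.
    apply: le_trans (ler_wpM2l (expR_ge0 _) (hill_profile_le delta c L d0 (ltW d1) c0 _)) _.
    rewrite -expRD ler_expR.
    have : `|theta| * `|y%:~R - a%:~R| <= `|theta| * L%:R.
      by rewrite ler_wpM2l // -natr_absz_sub ler_nat.
    lra.
  + rewrite -expRD ler_expR natr_absz_sub.
    have : `|theta| * `|y%:~R - a%:~R| <= B * `|y%:~R - a%:~R|.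
      by apply: ler_wpM2r.
    lra.
- apply: (@le_trans _ _ (expR (theta * a%:~R) * expR (- B * (absz (x - a)%R)%:R))).
    rewrite -expRD ler_expR natr_absz_sub.
    have := theta_dist x a; rewrite [`|x%:~R - _|]distrC => tax.
    have : (B + `|theta|) * `|a%:~R - x%:~R| <= (B + `|theta|) * (eta / (B + `|theta|
      + 1) * `|x%:~R| + `|C2|).
      by rewrite ler_wpM2l // (le_trans ax) // lerD2l ler_norm.
    have : (B + `|theta|) * (eta / (B + `|theta| + 1) * `|x%:~R|) <= eta * `|x%:~R|.
      rewrite mulrA ler_wpM2r // mulrA ler_pdivrMr // mulrC ler_wpM2l ?(ltW eta0) //.
      by rewrite lerDl.
    lra.
  by rewrite ler_wpM2l ?expR_ge0 // le_max lexx orbT.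
Qed.

(* The controller drives the walk to a valley near its starting point: two exponentially
   tilted solutions are glued at a point of the valley, where both are almost flat. *)
Lemma upper_growth_valleys V beta delta c g theta :
  (forall y, 0 <= V y) -> 0 <= beta < ln (cosh c) -> 0 <= delta <= 1 -> 0 < c ->
  tilt delta c -> good_potential V beta (ln (cosh c)) g -> has_valleys V ->
  `|theta| <= c - g -> upper_growth V beta delta 0 theta.
Proof.
move=> V0 /andP[b0 bl] /andP[d0 d1] c0 tc [[f Df] [k Dk]] valleys thetag eta eta0.
have ch := cosh_gt0 c; set s := c - g in thetag.
have s0 : 0 <= s := le_trans (normr_ge0 theta) thetag.
have eta20 : 0 < eta / 2 by rewrite divr_gt0.
have [h1 [N [/andP[h10 _] Hf]]] := valley_growth _ _ _ c0 b0 bl eta20.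
pose h : R := Num.min h1 (eta / (2 * (beta + 1))).
have b1 : 0 < beta + 1 by lra.
have h0 : 0 < h by rewrite lt_min h10 divr_gt0 // mulr_gt0.
have bh : beta * h <= eta / 2.
  apply: (@le_trans _ _ (beta * (eta / (2 * (beta + 1))))).
    by rewrite ler_wpM2l // ge_min lexx orbT.
  have -> : beta * (eta / (2 * (beta + 1))) = eta / 2 * (beta / (beta + 1)) by field; lra.
  by rewrite -[leRHS]mulr1 ler_wpM2l ?(ltW eta20) // ler_pdivrMr //; lra.
have eta40 : 0 < eta / 4 by rewrite divr_gt0.
have [f0 _ fE sf] := Df; have [k0 _ kE sk] := Dk.
have [C1 C10 H1] := slope_ge0_bound _ _ _ (slopeD _ _ _ _ (slope_linear c) sf) eta40.
have [C2 C20 H2] := slope_ge0_bound _ _ _ (slopeD _ _ _ _ (slope_linear (- c)) (slope_opp _ _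
  sk)) eta40.
have {}H1 y : `|(c * y%:~R + ln (f y)) - s * y%:~R| <= eta / 4 * `|y%:~R| + C1 by exact: H1.
have {}H2 y : `|(- c * y%:~R + ln (k (- y))) + s * y%:~R| <= eta / 4 * `|y%:~R| + C2.
  have := H2 y; rewrite /= (_ : - c - - g = - s) ?mulNr ?opprK //.
  by rewrite /s; ring.
(* The entry [1] gives [|a| <= 2 * |x| + |C3|]; the other keeps [2 * s * |a - x|] below
   [eta / 4 * |x|] up to a constant. *)
pose e2 : R := Num.min 1 (eta / (8 * (s + 1))).
have e20 : 0 < e2 by rewrite lt_min ltr01 divr_gt0 //; lra.
have se2 : 2 * s * e2 <= eta / 4.
  apply: (@le_trans _ _ (2 * s * (eta / (8 * (s + 1))))).
    by rewrite ler_wpM2l ?mulr_ge0 // ge_min lexx orbT.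
  have -> : 2 * s * (eta / (8 * (s + 1))) = eta / 4 * (s / (s + 1)) by field; lra.
  by rewrite -[leRHS]mulr1 ler_wpM2l ?(ltW eta40) // ler_pdivrMr //; lra.
have [C3 HC3] := valleys h N.+1 h0 _ e20.
exists (2 * C1 + 2 * C2 + (eta / 4 + 2 * s) * `|C3|) => x.
have [a [ax valley]] := HC3 x.
have {}ax : `|a%:~R - x%:~R| <= e2 * `|x%:~R| + `|C3|.
  by apply: le_trans ax _; rewrite lerD2l ler_norm.
pose P (y : int) : R := c * y%:~R + ln (f y).
pose Q (y : int) : R := - c * y%:~R + ln (k (- y)).
have PE y : expR (c * y%:~R) * f y = expR (P y) by rewrite /P expRD lnK ?posrE.
have QE y : expR (- c * y%:~R) * k (- y) = expR (Q y) by rewrite /Q expRD lnK ?posrE.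
(* On each side of [a] the control drifts towards [a]. [P] and [Q] have slopes [s] and [- s], so up
   to the allowed error [G] lies above [expR (theta * y)] on both sides when [|theta| <= s]. *)
pose G y := expR (theta * a%:~R) * (if (a <= y)%R then expR (P y - P a) else expR (Q y - Q a)).
have GP y : (a <= y)%R -> G y = expR (theta * a%:~R - P a) * (expR (c * y%:~R) * f y).
  by move=> ay; rewrite /G ay PE -!expRD; congr expR; ring.
have GQ y : (y <= a)%R -> G y = expR (theta * a%:~R - Q a) * (expR (- c * y%:~R) * k (- y)).
  rewrite /G; case: ifP => [ay ya|_ _].
    have -> : y = a by apply/le_anti/andP.
    by rewrite QE subrr expR0 mulr1 -expRD; congr expR; ring.
  by rewrite QE -!expRD; congr expR; ring.
have G0 y : 0 <= G y by rewrite mulr_ge0 ?expR_ge0 //; case: ifP => _; exact: expR_ge0.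
have e_eta : 1 <= expR (0 + eta) by rewrite add0r -expR0 ler_expR ltW.
have mean_eq y A B F : expR (beta * V y) * (A + B) = 2 * expR (ln (cosh c)) * F ->
    expR (beta * V y) * ((A + B) / (2 * cosh c)) = F.
  by rewrite lnK ?posrE // mulrA => ->; field; rewrite gt_eqF.
exists G; split=> [y|y|].
- have [ya|ay|->] := ltgtP y a.
  + exists ((1 + delta) / 2).
      by rewrite (_ : 2 * _ - 1 = delta) ?ger0_norm //; field.
    have [ya1 [ya2 ya3]] := ltz_neighbours _ _ ya; rewrite !GQ //.
    set E := expR (theta * a%:~R - Q a); set Ey := expR (- c * y%:~R).
    have -> : expR (- c * (y + 1)%:~R) = Ey * expR (- c) by rewrite -expRD intrD mulrDr mulr1.
    have -> : expR (- c * (y - 1)%:~R) = Ey * expR c.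
      by rewrite -expRD intrB mulrBr mulr1 opprK.
    have -> : (1 + delta) / 2 * (E * (Ey * expR (- c) * k (- (y + 1))))
        + (1 - (1 + delta) / 2) * (E * (Ey * expR c * k (- (y - 1))))
      = E * Ey * ((1 - delta) / 2 * (expR c * k (- (y - 1))) +
        (1 + delta) / 2 * (expR (- c) * k (- (y + 1)))) by field.
    rewrite (tilt_mean _ _ _ _ tc) [leLHS]mulrCA (mean_eq _ _ _ (k (- y))).
      by rewrite -[leLHS]mul1r -mulrA ler_wpM2r // !mulr_ge0 ?expR_ge0 // ltW.
    have := kE (- y); rewrite /= opprK => <-.
    by congr (_ * (k _ + k _)); ring.
  + exists ((1 - delta) / 2).
      by rewrite (_ : 2 * _ - 1 = - delta) ?normrN ?ger0_norm //; field.
    have [ya1 [ya2 ya3]] := gtz_neighbours _ _ ay; rewrite !GP //.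
    set E := expR (theta * a%:~R - P a); set Ey := expR (c * y%:~R).
    have -> : expR (c * (y + 1)%:~R) = Ey * expR c by rewrite -expRD intrD mulrDr mulr1.
    have -> : expR (c * (y - 1)%:~R) = Ey * expR (- c).
      by rewrite -expRD intrB mulrBr mulr1.
    have -> : (1 - delta) / 2 * (E * (Ey * expR c * f (y + 1)))
        + (1 - (1 - delta) / 2) * (E * (Ey * expR (- c) * f (y - 1)))
      = E * Ey * ((1 - delta) / 2 * (expR c * f (y + 1)) +
        (1 + delta) / 2 * (expR (- c) * f (y - 1))) by field.
    rewrite (tilt_mean _ _ _ _ tc) [leLHS]mulrCA (mean_eq _ _ _ (f y) (fE y)).
    by rewrite -[leLHS]mul1r -mulrA ler_wpM2r // !mulr_ge0 ?expR_ge0 // ltW.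
  (* At the gluing point the fair coin is used: each neighbour exceeds [G a] by a factor of at most
     [expR (eta / 2)], and [V a <= h] costs another [expR (eta / 2)]. *)
  + exists 2^-1; first by rewrite mulfV ?subrr ?normr0.
    have near_a (i : nat) z : (i < N)%N -> `|z - a| = i.+1%:Z -> V z <= h1.
      move=> iN za; apply: le_trans (valley z _) _; last by rewrite ge_min lexx.
      by rewrite -intrB -intr_norm za -[i.+1%:Z%:~R]/(i.+1%:R) ler_nat ltnW.
    have Gp : G (a + 1) <= expR (eta / 2) * G a.
      rewrite !GP //; last by rewrite lerDl.
      rewrite (_ : expR (eta / 2) * _ = expR (theta * a%:~R - P a) * (expR (c * a%:~R)
        * (expR (eta / 2) * f a))); last by ring.
      rewrite ler_pM2l ?expR_gt0 // intrD mulrDr mulr1 expRD -mulrA ler_pM2l ?expR_gt0 //.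
      by apply: Hf Df _ => i iN; apply: near_a iN _; exact: dist_right.
    have Gm : G (a - 1) <= expR (eta / 2) * G a.
      rewrite !GQ //; last by rewrite gerBl.
      rewrite (_ : expR (eta / 2) * _ = expR (theta * a%:~R - Q a) * (expR (- c * a%:~R)
        * (expR (eta / 2) * k (- a)))); last by ring.
      rewrite ler_pM2l ?expR_gt0 // intrB mulrBr mulr1 opprK expRD -mulrA ler_pM2l ?expR_gt0 //.
      rewrite (_ : - (a - 1) = - a + 1); last by ring.
      apply: Hf Dk _ => i iN; apply: near_a iN _.
      exact: dist_left.
    have Va : V a <= h by apply: valley; rewrite subrr normr0.
    have EV : expR (beta * V a) <= expR (eta / 2).
      by rewrite ler_expR; apply: le_trans bh; rewrite ler_wpM2l.
    apply: (@le_trans _ _ (expR (eta / 2) * (expR (eta / 2) * G a))).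
      move: (G0 (a + 1)) (G0 (a - 1)) Gp Gm; move: (G (a + 1)) (G (a - 1)) => u v ? ? ? ?.
      by apply: ler_pM; rewrite ?expR_ge0 //; lra.
    by rewrite mulrA -expRD add0r -splitr.
- have ax2 : `|a%:~R| <= 2 * `|x%:~R| + `|C3| :> R.
    have := ler_normD (a%:~R - x%:~R) (x%:~R : R); rewrite subrK.
    have : e2 * `|x%:~R| <= 1 * `|x%:~R| by rewrite ler_wpM2r // ge_min lexx.
    by move: ax; lra.
  have eax : eta / 4 * `|a%:~R| <= eta / 4 * (2 * `|x%:~R| + `|C3|).
    by rewrite ler_wpM2l // ltW.
  have x0 := mulr_ge0 (ltW eta0) (normr_ge0 (x%:~R : R)).
  have y0 := mulr_ge0 (ltW eta0) (normr_ge0 (y%:~R : R)).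
  have c30 : 0 <= s * `|C3| by rewrite mulr_ge0.
  move: thetag; rewrite ler_norml => /andP[t1 t2].
  rewrite /G; case: ifP => ay; rewrite -expRD ler_expR.
    have : 0 <= (s - theta) * (y%:~R - a%:~R).
      by rewrite mulr_ge0 ?subr_ge0 ?ler_int.
    have := H1 y; have := H1 a; rewrite -/(P y) -/(P a) !ler_norml => /andP[? ?] /andP[? ?] ?.
    by lra.
  have : 0 <= (s + theta) * (a%:~R - y%:~R).
    rewrite mulr_ge0 ?subr_ge0 ?ler_int //; first by lra.
    by rewrite ltW // ltNge ay.
  have := H2 y; have := H2 a; rewrite -/(Q y) -/(Q a) !ler_norml => /andP[? ?] /andP[? ?] ?.
  by lra.
- have ax2 : `|a%:~R| <= 2 * `|x%:~R| + `|C3| :> R.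
    have := ler_normD (a%:~R - x%:~R) (x%:~R : R); rewrite subrK.
    have : e2 * `|x%:~R| <= 1 * `|x%:~R| by rewrite ler_wpM2r // ge_min lexx.
    by move: ax; lra.
  have eax : eta / 4 * `|a%:~R| <= eta / 4 * (2 * `|x%:~R| + `|C3|).
    by rewrite ler_wpM2l // ltW.
  have sax : 2 * s * `|a%:~R - x%:~R| <= eta / 4 * `|x%:~R| + 2 * s * `|C3|.
    apply: le_trans (ler_wpM2l _ ax) _; first by rewrite mulr_ge0.
    by rewrite mulrDr lerD2r mulrA ler_wpM2r.
  have tax : theta * a%:~R <= theta * x%:~R + s * `|a%:~R - x%:~R|.
    rewrite -lerBlDl -mulrBr; apply: le_trans (ler_norm _) _.
    by rewrite normrM ler_wpM2r.
  have c30 : 0 <= s * `|C3| by rewrite mulr_ge0.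
  rewrite /G; case: ifP => axx; rewrite -expRD ler_expR.
    have : s * (x%:~R - a%:~R) <= s * `|a%:~R - x%:~R|.
      by rewrite ler_wpM2l // distrC ler_norm.
    have := H1 x; have := H1 a; rewrite -/(P x) -/(P a) !ler_norml => /andP[? ?] /andP[? ?] ?.
    by lra.
  have : s * (a%:~R - x%:~R) <= s * `|a%:~R - x%:~R|.
    by rewrite ler_wpM2l // ler_norm.
  have := H2 x; have := H2 a; rewrite -/(Q x) -/(Q a) !ler_norml => /andP[? ?] /andP[? ?] ?.
  by lra.
Qed.

End growth_constructions.

(** * Random environments *)

Section two_sided.
Context {d : measure_display} {Omega : measurableType d} {R : realType}.
Variables (P : probability Omega R).
Implicit Types (T Ti : Omega -> Omega) (g V U : Omega -> R) (w : Omega) (x y : int).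

(** Relations between rates are deterministic, so they can be proved in one environment that has the
    required almost sure properties. *)
Lemma ae_ex (Q : Omega -> Prop) : {ae P, forall w, Q w} -> exists w, Q w.
Proof.
move=> aeQ; apply/not_existsP => nQ; have [N [mN PN sN]] := aeQ.
suff : P setT = 0%E.
  by have := probability_setT P; rewrite /= => -> [] /eqP; rewrite oner_eq0.
apply/eqP; rewrite eq_le measure_ge0 andbT -PN; apply: le_measure; rewrite ?inE //.
by move=> w _; apply: sN => /= Qw; exact: nQ Qw.
Qed.

Lemma invertible_mpt_sym T Ti : invertible_mpt P T Ti -> invertible_mpt P Ti T.
Proof.
move=> [TK TiK mT mTi PT]; split => // A mA.
have mTiA : measurable (Ti @^-1` A) by rewrite -[X in measurable X]setTI; exact: mTi.
rewrite -PT //; congr (P _).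
by apply/seteqP; split => w /=; rewrite TK.
Qed.

Lemma ergodic_inverse T Ti : invertible_mpt P T Ti -> ergodic P T -> ergodic P Ti.
Proof.
move=> [TK TiK _ _ _] erg A mA TiA; apply: erg => //.
by rewrite -{1}TiA; apply/seteqP; split => w /=; rewrite TK.
Qed.

Lemma TpowS T Ti x w : cancel Ti T -> Tpow T Ti (x + 1) w = T (Tpow T Ti x w).
Proof.
move=> TiK; case: x => n; first by rewrite /= addn1.
case: n => [|n]; first by rewrite /= TiK.
by rewrite (_ : Negz n.+1 + 1 = Negz n) /= ?TiK //; lia.
Qed.

Lemma Tpow_opp T Ti x w : Tpow Ti T x w = Tpow T Ti (- x) w.
Proof. by case: x => [[|n]|n]. Qed.

Lemma TpowD T Ti x (n : nat) w : cancel Ti T ->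
  Tpow T Ti (x + n%:Z) w = iter n T (Tpow T Ti x w).
Proof.
move=> TiK; elim: n => [|n IH]; first by rewrite addr0.
by rewrite -addn1 PoszD addrA TpowS // IH addn1.
Qed.

Lemma env_opp T Ti V w : env Ti T V w = env T Ti V w \o -%R.
Proof. by apply/funext => x; rewrite /env /= Tpow_opp. Qed.

Lemma ae_birkhoff T (f : Omega -> R) (B : R) : measurable_fun setT T ->
  (forall A, measurable A -> P (T @^-1` A) = P A) -> ergodic P T ->
  measurable_fun setT f -> (forall w, `|f w| <= B) ->
  {ae P, forall w, forall eta : R, 0 < eta -> exists C : R, forall n,
     `|\sum_(i < n) f (iter i T w) - n%:R * \int[P]_w f w| <= eta * n%:R + C}.
Proof.
move=> mT PT erg mf fB.
have mNf : measurable_fun setT (fun w => - f w) by apply: measurableT_comp.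
have NfB w : `|- f w| <= B by rewrite normrN.
have intN : \int[P]_w (- f w) = - \int[P]_w f w.
  rewrite -mulN1r -RintegralZl //; last exact: bounded_integrable fB.
  by apply: eq_Rintegral => w _; rewrite mulN1r.
have e0 k : 0 < k.+1%:R^-1 :> R by rewrite invr_gt0.
(* The errors [1 / (k + 1)] cover all [eta], which leaves countably many null sets. *)
have H1 := ae_foralln (fun k => ae_birkhoff_sum_le P T mT PT erg f B _ mf fB (e0 k)).
have H2 := ae_foralln (fun k => ae_birkhoff_sum_le P T mT PT erg _ B _ mNf NfB (e0 k)).
apply: filterS2 H1 H2 => w H1 H2 eta eta0.
pose k := Num.truncn eta^-1.
have ke : k.+1%:R^-1 <= eta.
  by rewrite -[leRHS]invrK lef_pV2 ?posrE ?invr_gt0 // ltW // truncnS_gt.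
have [C1 {}H1] := H1 k; have [C2 {}H2] := H2 k; exists (Num.max C1 C2) => n.
have := H1 n; have := H2 n; rewrite intN sumrN.
have : n%:R * k.+1%:R^-1 <= eta * n%:R by rewrite mulrC ler_wpM2r.
have : C1 <= Num.max C1 C2 /\ C2 <= Num.max C1 C2 by rewrite !le_max !lexx orbT.
rewrite ler_norml; move: (Num.max C1 C2) (\sum_(i < n) f (iter i T w)) (\int[P]_w f w).
by move: k.+1%:R^-1 => r M S I [? ?] ? ? ?; lra.
Qed.

(** [F] is the additive cocycle of [g], built from [T] to the right and from [Ti] to the left; both
    averages are the integral of [g] because both maps preserve the measure and are ergodic. *)
Lemma ae_slope T Ti g (B : R) : invertible_mpt P T Ti -> ergodic P T ->
  measurable_fun setT g -> (forall w, `|g w| <= B) ->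
  {ae P, forall w, exists F : int -> R, slope F (\int[P]_w g w) /\
     forall x, F (x + 1) - F x = g (Tpow T Ti (x + 1) w)}.
Proof.
move=> hT erg mg gB; have [TK TiK mT mTi PT] := hT.
have [_ _ _ _ PTi] := invertible_mpt_sym _ _ hT.
have mgT : measurable_fun setT (fun w => g (T w)) by exact: measurableT_comp.
have H1 := ae_birkhoff T (fun w => g (T w)) B mT PT erg mgT (fun w => gB _).
have H2 := ae_birkhoff Ti g B mTi PTi (ergodic_inverse _ _ hT erg) mg gB.
apply: filterS2 H1 H2 => w; rewrite (Rintegral_invariant P T mT PT g B mg gB).
set I := \int[P]_w g w => H1 H2.
(* The increment into [x + 1] is read at [x + 1], so the forward sum starts at [T w] and the
   backward sum at [w]. *)
exists (fun x => match x with Posz n => \sum_(i < n) g (T (iter i T w))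
  | Negz n => - \sum_(i < n.+1) g (iter i Ti w) end); split.
  move=> eta eta0; have [C1 {}H1] := H1 eta eta0; have [C2 {}H2] := H2 eta eta0.
  have CM : C1 <= Num.max C1 C2 /\ C2 <= Num.max C1 C2 by rewrite !le_max !lexx orbT.
  exists (Num.max C1 C2); move: (Num.max C1 C2) CM => M [CM1 CM2] [n|n].
    rewrite -[(Posz n)%:~R]/(n%:R) (ger0_norm (ler0n R n)) [I * _]mulrC.
    by apply: le_trans (H1 n) _; rewrite lerD2l.
  rewrite NegzE rmorphN /= normrN mulrN opprK addrC -opprB normrN.
  rewrite -[n.+1%:~R]/(n.+1%:R) (ger0_norm (ler0n R n.+1)).
  by rewrite [I * _]mulrC; apply: le_trans (H2 n.+1) _; rewrite lerD2l.
case=> [n|[|n]].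
- by rewrite /= addn1 big_ord_recr /= addrAC subrr add0r.
- by rewrite /= big_ord0 big_ord_recl big_ord0 addr0 sub0r opprK.
- rewrite (_ : Negz n.+1 + 1 = Negz n); last by lia.
  by rewrite opprK [X in _ + X]big_ord_recr addKr.
Qed.


End two_sided.

(** * Continued fractions of the environment *)

Section ratio_limit.
Context {d : measure_display} {Omega : measurableType d} {R : realType}.
Variables (T : Omega -> Omega) (U : Omega -> R) (m : R).
Hypotheses (m0 : 0 < m) (Um : forall w, m <= U w).

(* Truncated continued fractions for the ratio f(x) / f(x - 1) of the decaying solution. *)
Fixpoint ratio_iter (n : nat) (w : Omega) : R :=
  if n is k.+1 then (2 * expR (U w) - ratio_iter k (T w))^-1 else 0.

Lemma ratio_denom_ge (r : R) w : 0 <= r <= expR (- m) -> expR m <= 2 * expR (U w) - r.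
Proof.
move=> /andP[r0 rm]; have : expR m <= expR (U w) by rewrite ler_expR.
have : expR (- m) <= expR m by rewrite ler_expR; have := m0; lra.
lra.
Qed.

Lemma ratio_iter_bounds n w : 0 <= ratio_iter n w <= expR (- m).
Proof.
elim: n w => [|n IH] w /=; first by rewrite lexx expR_ge0.
have H := ratio_denom_ge _ w (IH (T w)).
have H0 := lt_le_trans (expR_gt0 m) H.
rewrite invr_ge0 ltW //= expRN lef_pV2 // posrE //; exact: expR_gt0.
Qed.

Lemma ratio_iter_homo w : {homo ratio_iter ^~ w : i j / (i <= j)%N >-> i <= j}.
Proof.
apply: homo_leq => [x|x y z|n]; [exact: lexx|exact: le_trans|].
elim: n w => [|n IH] w; first by have /andP[] := ratio_iter_bounds 1 w.
have H k := lt_le_trans (expR_gt0 m) (ratio_denom_ge _ w (ratio_iter_bounds k (T w))).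
by rewrite /= lef_pV2 ?posrE //; [rewrite lerD2l lerN2 | exact: (H n.+1)].
Qed.

Lemma measurable_ratio_iter n : measurable_fun setT T -> measurable_fun setT U ->
  measurable_fun setT (ratio_iter n).
Proof.
move=> mT mU; elim: n => [|n IH]; first exact: measurable_cst.
have -> : ratio_iter n.+1 =
    (fun w => expR (- ln (2 * expR (U w) - ratio_iter n (T w)))).
  apply/funext => w /=; rewrite expRN lnK // posrE.
  exact: lt_le_trans (expR_gt0 m) (ratio_denom_ge _ w (ratio_iter_bounds n (T w))).
apply: measurableT_comp; first exact: measurable_expR.
apply: measurableT_comp => //.
apply: measurableT_comp; first exact: measurable_ln.
apply: measurable_funB; last exact: measurableT_comp.
by apply: measurable_funM => //; apply: measurableT_comp => //; exact: measurable_expR.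
Qed.

Definition ratio_lim w := limn (fun n => ratio_iter n w).

Lemma ratio_iter_cvg w : ratio_iter n w @[n --> \oo] --> ratio_lim w.
Proof.
apply: nondecreasing_is_cvgn; first exact: ratio_iter_homo.
by exists (expR (- m)) => _ [n _ <-]; have /andP[] := ratio_iter_bounds n w.
Qed.

Lemma ratio_lim_bounds w : ((2 * expR (U w))^-1 <= ratio_lim w) /\ (ratio_lim w <= expR (- m)).
Proof.
split.
  have := nondecreasing_cvgn_le (ratio_iter_homo w) (ratio_iter_cvg w) 1%N.
  by rewrite /= subr0.
apply: limr_le; first exact: ratio_iter_cvg.
by apply: nearW => n; have /andP[] := ratio_iter_bounds n w.
Qed.

Lemma ratio_lim_gt0 w : 0 < ratio_lim w.
Proof.
have [H _] := ratio_lim_bounds w; apply: lt_le_trans H.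
by rewrite invr_gt0 mulr_gt0 ?expR_gt0.
Qed.

Lemma ratio_lim_eq w : (ratio_lim w)^-1 + ratio_lim (T w) = 2 * expR (U w).
Proof.
have H1 : ratio_iter n.+1 w @[n --> \oo] --> ratio_lim w.
  by have := ratio_iter_cvg w; rewrite -(cvg_shiftS (fun n => ratio_iter n w)).
have D0 : 0 < 2 * expR (U w) - ratio_lim (T w).
  apply: lt_le_trans (expR_gt0 m) (ratio_denom_ge _ w _).
  by rewrite ltW ?ratio_lim_gt0 //; have [] := ratio_lim_bounds (T w).
have H2 : ratio_iter n.+1 w @[n --> \oo] --> (2 * expR (U w) - ratio_lim (T w))^-1.
  apply: cvgV; first by rewrite gt_eqF.
  by apply: cvgB; [exact: cvg_cst | exact: ratio_iter_cvg].
have -> : ratio_lim w = (2 * expR (U w) - ratio_lim (T w))^-1.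
  exact: cvg_unique H1 H2.
by rewrite invrK subrK.
Qed.

Lemma measurable_ratio_lim : measurable_fun setT T -> measurable_fun setT U ->
  measurable_fun setT ratio_lim.
Proof.
move=> mT mU; apply: (measurable_fun_cvg (h := ratio_iter)) => [n|w _].
  exact: measurable_ratio_iter.
exact: ratio_iter_cvg.
Qed.

End ratio_limit.

Section solutions.
Context {d : measure_display} {Omega : measurableType d} {R : realType}.
Variables (P : probability Omega R).
Implicit Types (T Ti : Omega -> Omega) (V : Omega -> R) (beta lam : R).

(** The logarithm of the limiting ratio is bounded above and below, so its cocycle has a slope, and
    the exponential of the cocycle is the solution. *)
Lemma ae_decaying_solution T Ti V beta lam :
  invertible_mpt P T Ti -> ergodic P T -> measurable_fun setT V ->
  (forall w, 0 <= V w <= 1) -> 0 <= beta < lam ->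
  exists g, {ae P, forall w, exists f, decaying_solution (env T Ti V w) beta lam g f}.
Proof.
move=> hT erg mV V01 /andP[b0 bl]; have [TK TiK mT mTi PT] := hT.
pose U w := lam - beta * V w.
have Um w : lam - beta <= U w.
  by rewrite lerD2l lerN2 ler_piMr //; have /andP[] := V01 w.
have Ulam w : U w <= lam.
  by rewrite gerBl mulr_ge0 //; have /andP[] := V01 w.
have m0 : 0 < lam - beta by rewrite subr_gt0.
have mU : measurable_fun setT U.
  by apply: measurable_funB => //; exact: measurable_funM.
pose r : Omega -> R := ratio_lim T U; have rb w := ratio_lim_bounds T U (lam - beta) m0 Um w.
have r0 w : 0 < r w := ratio_lim_gt0 T U (lam - beta) m0 Um w.
have rE w := ratio_lim_eq T U (lam - beta) m0 Um w.
have mr : measurable_fun setT (fun w => ln (r w)).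
  apply: measurableT_comp; first exact: measurable_ln.
  exact: (measurable_ratio_lim T U (lam - beta) m0 Um mT mU).
have rB w : `|ln (r w)| <= ln (2 * expR lam).
  rewrite ler_norml; apply/andP; split.
    rewrite -lnV ?posrE ?mulr_gt0 ?expR_gt0 // ler_ln ?posrE ?invr_gt0 ?mulr_gt0 ?expR_gt0 //.
    have [H _] := rb w; apply: le_trans H; rewrite lef_pV2 ?posrE ?mulr_gt0 ?expR_gt0 //.
    by rewrite ler_pM2l // ler_expR.
  apply: (@le_trans _ _ 0).
    by apply: ln_le0; have [_ H] := rb w; apply: le_trans H _; rewrite expR_le1 oppr_le0 ltW.
  apply: ln_ge0; have : 1 <= expR lam by rewrite -expR0 ler_expR ltW // (le_lt_trans b0).
  lra.
exists (- \int[P]_w ln (r w)); apply: filterS (ae_slope P T Ti _ _ hT erg mr rB) => w.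
move=> [F [sF FE]]; exists (fun y => expR (F y)).
have FS y : expR (F (y + 1)) = r (Tpow T Ti (y + 1) w) * expR (F y).
  by rewrite -[F (y + 1)](subrK (F y)) FE expRD lnK ?posrE.
split=> [y|y|y|].
- exact: expR_gt0.
- rewrite FS ler_pM2r ?expR_gt0 //; have [_] := rb (Tpow T Ti (y + 1) w).
  by rewrite opprB.
- have E : (r (Tpow T Ti y w))^-1 + r (Tpow T Ti (y + 1) w)
      = 2 * expR (U (Tpow T Ti y w)) by rewrite TpowS //; exact: rE.
  have Fm : expR (F (y - 1)) = (r (Tpow T Ti y w))^-1 * expR (F y).
    have := FS (y - 1); rewrite subrK => ->; rewrite mulrA mulVf ?mul1r //.
    by rewrite gt_eqF.
  rewrite FS Fm -mulrDl [r _ + _]addrC E /U expRB mulrA mulrCA.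
  by rewrite /env; field; rewrite gt_eqF ?expR_gt0.
- under [X in slope X]funext do rewrite expRK.
  by rewrite opprK.
Qed.

End solutions.

(** * Sublinear gaps, reflection, and lower bounds from solutions *)

Section recurrence.
Context {R : realType}.
Implicit Types (V : int -> R) (beta delta lam mu theta c g : R).

(** [F] counts the points of [Q]; it would be constant along a long gap, against its positive
    slope. *)
Lemma recurrent_of_slope (Q : int -> bool) (F : int -> R) (p : R) : 0 < p -> slope F p ->
  (forall x, F (x + 1) - F x = (Q (x + 1))%:R) -> recurrent (R := R) Q.
Proof.
move=> p0 sF FE eta eta0.
pose e : R := Num.min (p / 2) (eta * p / 4).
have e0 : 0 < e by rewrite lt_min !divr_gt0 // mulr_gt0.
have [C C0 HC] := slope_ge0_bound _ _ _ sF e0.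
have ep : e <= p / 2 by rewrite ge_min lexx.
have ee : e <= eta * p / 4 by rewrite ge_min lexx orbT.
exists (4 * C / p + 1) => x; apply/not_existsP => nQ.
(* A gap of length [d] to the right of [x] forces [p / 2 * d <= p / 2 * B], which contradicts
   [B < d]. *)
pose B : R := eta * `|x%:~R| + 4 * C / p.
have B0 : 0 <= B by rewrite addr_ge0 ?mulr_ge0 ?invr_ge0 // ltW.
pose d := (Num.truncn B).+1.
have Bd : B < d%:R := truncnS_gt B.
have dB : d%:R <= B + 1.
  by rewrite -natr1 lerD2r; have /andP[] := truncn_itv B0.
have Fd (i : nat) : (i <= d)%N -> F (x + i%:Z) = F x.
  elim: i => [|i IH] id; first by rewrite addr0.
  rewrite -addn1 PoszD addrA; apply/eqP; rewrite -subr_eq0 -(IH (ltnW id)) FE.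
  have := nQ (x + i%:Z + 1); case: (Q _) => // nQi; exfalso; apply: nQi; split => //.
  have -> : (x + i%:Z + 1)%:~R - x%:~R = i.+1%:R :> R.
    by rewrite !intrD -[i%:Z%:~R]/(i%:R) mulr1z -natr1; ring.
  rewrite ger0_norm //.
  apply: le_trans (_ : d%:R <= _); first by rewrite ler_nat.
  by move: dB; rewrite /B addrA.
have := HC x; have := HC (x + d%:Z); rewrite Fd // intrD -[d%:Z%:~R]/(d%:R).
have xd : `|x%:~R + d%:R| <= `|x%:~R| + d%:R :> R.
  by apply: le_trans (ler_normD _ _) _; rewrite lerD2l ger0_norm.
have exd := ler_wpM2l (ltW e0) xd.
have ped : p * d%:R <= 2 * e * `|x%:~R| + e * d%:R + 2 * C -> False.
  move=> H.
  have H1 : e * d%:R <= p / 2 * d%:R by rewrite ler_wpM2r.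
  have H2 : e * `|x%:~R| <= eta * p / 4 * `|x%:~R| by rewrite ler_wpM2r.
  have : p / 2 * d%:R <= p / 2 * B.
    have -> : p / 2 * B = eta * p / 4 * (2 * `|x%:~R|) + 2 * C.
      by rewrite /B; field; rewrite gt_eqF.
    lra.
  by rewrite ler_pM2l ?divr_gt0 // leNgt Bd.
rewrite !ler_norml => /andP[? ?] /andP[? ?]; apply: ped; lra.
Qed.

Lemma int_window (y a : int) (L : nat) : `|y - a| <= L%:Z ->
  exists n : nat, (n <= L.*2.+1)%N /\ y = a - L%:Z + n%:Z.
Proof. by move=> H; exists (absz (y - a + L%:Z)%R); lia. Qed.

Lemma recurrent_shift (Q : int -> Prop) (k : int) :
  recurrent (R := R) Q -> recurrent (R := R) (fun a => Q (a - k)).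
Proof.
move=> H eta eta0; have [C HC] := H eta eta0.
exists (C + `|k%:~R|) => x; have [a [ax Qa]] := HC x; exists (a + k).
rewrite addrK; split => //; rewrite intrD addrAC addrA.
by apply: le_trans (ler_normD _ _) _; rewrite lerD2r.
Qed.

Lemma recurrent_sub (Q Q' : int -> Prop) :
  (forall a, Q a -> Q' a) -> recurrent (R := R) Q -> recurrent (R := R) Q'.
Proof.
move=> QQ' H eta eta0; have [C HC] := H eta eta0; exists C => x.
by have [a [ax Qa]] := HC x; exists a; split => //; exact: QQ'.
Qed.

Lemma recurrent_opp (Q : int -> Prop) : recurrent (R := R) Q -> recurrent (R := R) (Q \o -%R).
Proof.
move=> H eta eta0; have [C HC] := H eta eta0; exists C => x.
have [a [ax Qa]] := HC (- x); exists (- a); rewrite /= opprK; split => //.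
by move: ax; rewrite !rmorphN normrN -opprD normrN opprK -[a%:~R + _]opprK normrN opprD.
Qed.

Lemma comp_oppK V : (V \o -%R) \o -%R = V.
Proof. by apply/funext => x /=; rewrite opprK. Qed.

Lemma good_potential_opp V beta lam g :
  good_potential V beta lam g -> good_potential (V \o -%R) beta lam g.
Proof. by case=> H1 H2; split => //; rewrite comp_oppK. Qed.

Lemma has_hills_opp V : has_hills V -> has_hills (V \o -%R).
Proof.
move=> H h L h1; apply: recurrent_sub (recurrent_opp _ (H h L h1)) => a /= Ha y ya.
apply: Ha; move: ya; rewrite !rmorphN -normrN; congr (is_true (`| _ | <= _)); ring.
Qed.

Lemma has_valleys_opp V : has_valleys V -> has_valleys (V \o -%R).
Proof.
move=> H h L h1; apply: recurrent_sub (recurrent_opp _ (H h L h1)) => a /= Ha y ya.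
apply: Ha; move: ya; rewrite !rmorphN -normrN; congr (is_true (`| _ | <= _)); ring.
Qed.

Lemma upper_growth_le V beta delta mu1 mu2 theta : mu1 <= mu2 ->
  upper_growth V beta delta mu1 theta -> upper_growth V beta delta mu2 theta.
Proof.
move=> mu12 H eta eta0; have [C HC] := H eta eta0; exists C => x.
have [G [superG Gge Gx]] := HC x; exists G; split => // y.
have [q hq Hq] := superG y; exists q => //; apply: le_trans Hq _.
rewrite ler_wpM2r ?ler_expR ?lerD2r //; exact: le_trans (expR_ge0 _) (Gge y).
Qed.

Lemma tilt0 : tilt (0 : R) 0.
Proof. by rewrite /tilt /cosh oppr0 expR0; split; field. Qed.

(** Reflecting the potential changes the sign of [theta], so in a class closed under reflection only
    [theta >= 0] has to be treated. *)
Lemma growth_abs (Q : (int -> R) -> Prop) beta delta mu theta :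
  (forall V, Q V -> Q (V \o -%R)) ->
  (forall V, Q V -> lower_growth V beta delta mu `|theta| /\
                    upper_growth V beta delta mu `|theta|) ->
  forall V, Q V -> lower_growth V beta delta mu theta /\
                   upper_growth V beta delta mu theta.
Proof.
move=> Qopp H V QV; have [t0|t0] := leP 0 theta.
  by have := H V QV; rewrite ger0_norm.
have [Hl Hu] := H _ (Qopp V QV); rewrite -[theta]opprK -(ltr0_norm t0).
by split; [exact: lower_growth_opp | exact: upper_growth_opp].
Qed.

(** The growing solution increases even before multiplication by [expR (c * y)], so every
    [lam > beta] is allowed. *)
Lemma lower_growth_right V beta delta lam c g :
  (forall y, 0 <= V y) -> 0 <= delta <= 1 -> tilt delta c -> 0 <= c -> beta < lam ->
  good_potential V beta lam g ->
  lower_growth V beta delta (lam - ln (cosh c)) (c + g).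
Proof.
move=> V0 d01 tc c0 bl [_ [k [k0 kd kE sk]]].
apply: (lower_growth_increasing V beta beta delta c lam g (fun y => k (- y))) => //.
- move=> y; have := kd (- y - 1); rewrite subrK => /le_trans; apply.
  rewrite (_ : - (y + 1) = - y - 1); last by ring.
  by rewrite ler_pM2r // ler_expR; lra.
- move=> y; have := kE (- y); rewrite /= opprK => <-.
  by rewrite addrC; congr (_ * (k _ + k _)); ring.
- by have := slope_opp _ _ sk; rewrite opprK.
Qed.

(** For the decaying solution the product with [expR (c * y)] increases only thanks to
    [lam <= ln (cosh c)]. The parameter [beta1] serves the trapped regime. *)
Lemma lower_growth_left V beta1 beta delta lam c g :
  (forall y, 0 <= V y <= 1) -> 0 <= delta <= 1 -> tilt delta c -> 0 < c ->
  0 <= beta1 <= beta -> beta1 < lam -> lam <= ln (cosh c) ->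
  good_potential V beta1 lam g ->
  lower_growth V beta delta (lam - ln (cosh c)) (c - g).
Proof.
move=> V01 d01 tc c0 /andP[b10 b1] bl lc [[f Df] _].
have [f0 _ fE sf] := Df.
apply: (lower_growth_increasing V beta1 beta delta c lam (- g) f) => //.
  by move=> y; have /andP[] := V01 y.
exact: (decaying_solution_le_expR V beta1 lam g c f V01 c0 b10 bl Df lc).
Qed.

End recurrence.

(** * Almost sure properties of the environment and the rate function *)

Section random_environment.
Context {d : measure_display} {Omega : measurableType d} {R : realType}.
Variables (P : probability Omega R) (T Ti : Omega -> Omega) (V : Omega -> R).
Hypotheses (hT : invertible_mpt P T Ti) (erg : ergodic P T).
Hypotheses (mV : measurable_fun setT V) (V01 : forall w, 0 <= V w <= 1).
Implicit Types (beta lam c g h : R) (w : Omega) (x y : int).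

Notation potential := (env T Ti V).

Lemma ae_good_potential beta lam : 0 <= beta < lam ->
  exists g, {ae P, forall w, good_potential (potential w) beta lam g}.
Proof.
move=> bl; have /andP[_ bl'] := bl.
have [g Hg] := ae_decaying_solution P T Ti V beta lam hT erg mV V01 bl.
have [g' Hg'] := ae_decaying_solution P Ti T V beta lam (invertible_mpt_sym _ _ _ hT)
  (ergodic_inverse _ _ _ hT erg) mV V01 bl.
have H : {ae P, forall w, good_potential (potential w) beta lam g /\ g = g'}.
  apply: filterS2 Hg Hg' => w [f Df] [k]; rewrite env_opp => Dk.
  have E := decaying_solution_opp_rate _ _ _ _ _ _ _ bl' Df Dk.
  by split => //; split; [exists f | exists k; rewrite E].
by exists g; apply: filterS H => w [].
Qed.

Lemma ae_recurrent (Q : Omega -> bool) : measurable [set w | Q w] ->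
  (0 < P [set w | Q w])%E ->
  {ae P, forall w, exists (F : int -> R) (p : R), [/\ 0 < p, slope F p &
    forall x, F (x + 1) - F x = (Q (Tpow T Ti (x + 1) w))%:R]}.
Proof.
move=> mQ PQ.
have IE : (fun w => (Q w)%:R) = \1_[set w | Q w] :> (Omega -> R).
  by apply/funext => w; rewrite indicE mem_setE.
have mI : measurable_fun setT (fun w => (Q w)%:R : R).
  by rewrite IE; exact: measurable_indic.
have IB w : `|(Q w)%:R : R| <= 1 by case: (Q w); rewrite ?normr1 ?normr0.
have p0 : 0 < \int[P]_w ((Q w)%:R : R).
  rewrite /Rintegral (_ : (\int[P]_w _)%E = P [set w | Q w]).
    by rewrite fine_gt0 // PQ /= ltey_eq fin_num_measure.
  rewrite -(setIT [set w | Q w]) -integral_indic //.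
  by apply: eq_integral => w _; rewrite -IE.
apply: filterS (ae_slope P T Ti _ 1 hT erg mI IB) => w [F [sF FE]].
by exists F, (\int[P]_w ((Q w)%:R : R)).
Qed.

Lemma measurable_Tpow x : measurable_fun setT (Tpow T Ti x).
Proof.
have [_ _ mT mTi _] := hT.
have miter (S : Omega -> Omega) n : measurable_fun setT S -> measurable_fun setT (iter n S).
  move=> mS; elim: n => [|n IH]; first exact: measurable_id.
  exact: (measurableT_comp mS IH).
by case: x => n; exact: miter.
Qed.

Lemma measurable_window (Q : R -> bool) (l : nat) : measurable [set r | Q r] ->
  measurable [set w | forall y : nat, (y <= l)%N -> Q (V (Tpow T Ti y%:Z w))].
Proof.
move=> mQ; have -> : [set w | forall y : nat, (y <= l)%N -> Q (V (Tpow T Ti y%:Z w))]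
    = \bigcap_(y in [set y : nat | (y <= l)%N])
      ((fun w => V (Tpow T Ti y%:Z w)) @^-1` [set r | Q r]).
  by apply/seteqP; split => w.
apply: bigcap_measurable => [|y _]; first by exists 0%N.
rewrite -[X in measurable X]setTI.
by apply: (measurableT_comp mV (measurable_Tpow y%:Z)).
Qed.

Lemma ae_recurrent_window (Q : R -> bool) (l : nat) :
  measurable [set r | Q r] ->
  (0 < P [set w | forall y : nat, (y <= l)%N -> Q (V (Tpow T Ti y%:Z w))])%E ->
  {ae P, forall w, recurrent (R := R) (fun a => forall y : nat, (y <= l)%N ->
     Q (potential w (a + y%:Z)))}.
Proof.
move=> mQ PQ; set A := [set w | _] in PQ.
have mA : measurable A by exact: measurable_window.
have AE : A = [set w | `[< A w >]].
  by apply/seteqP; split => w /= /asboolP.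
rewrite AE in PQ mA.
apply: filterS (ae_recurrent (fun w => `[< A w >]) mA PQ) => w [F [p [p0 sF FE]]].
apply: recurrent_sub (recurrent_of_slope (fun x => `[< A (Tpow T Ti x w) >]) F p p0 sF FE).
move=> a /asboolP /= H y yl; rewrite /env; have := H y yl.
have [_ TiK _ _ _] := hT.
by rewrite TpowD // -[y%:Z]add0r TpowD.
Qed.

Lemma window_centered (Q : R -> bool) (L : nat) w :
  recurrent (R := R) (fun a => forall y : nat, (y <= L.*2.+1)%N -> Q (potential w (a + y%:Z))) ->
  recurrent (R := R) (fun a => forall y, `|y%:~R - a%:~R| <= L%:R :> R -> Q (potential w y)).
Proof.
move=> /(recurrent_shift _ L%:Z); apply: recurrent_sub => a H y.
rewrite -intrB -intr_norm -[L%:R]/(L%:Z%:~R) ler_int => yaL.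
have [n [nL ->]] : exists n : nat, (n <= L.*2.+1)%N /\ y = a - L%:Z + n%:Z.
  by apply: int_window.
exact: H.
Qed.

Lemma measurable_ge h : measurable [set r : R | h <= r].
Proof.
rewrite (_ : [set r | _] = `[h, +oo[%classic); first exact: measurable_itv.
by apply/seteqP; split => r /=; rewrite in_itv /= andbT.
Qed.

Lemma ae_has_hills :
  (forall h (l : nat), 0 < h < 1 -> (0 < l)%N ->
     (0 < P [set w | forall y : nat, (y <= l)%N -> (h <= V (Tpow T Ti y%:Z w))%R])%E) ->
  {ae P, forall w, has_hills (potential w)}.
Proof.
move=> hhill; pose hk (k : nat) : R := 1 - k.+2%:R^-1.
have hk01 k : 0 < hk k < 1.
  by rewrite subr_gt0 gtrBl invf_lt1 ?invr_gt0 ?ltr1n ?ltr0n.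
have mh k := measurable_ge (hk k).
(* The length [L.*2.+1] covers a window of radius [L] and is positive even for [L = 0]. *)
have H := ae_foralln (fun k => ae_foralln (fun L : nat =>
  ae_recurrent_window (fun r => hk k <= r) L.*2.+1 (mh k) (hhill _ _ (hk01 k) (ltn0Sn L.*2)))).
apply: filterS H => w H h L h1.
have h10 : 0 < 1 - h by rewrite subr_gt0.
pose k := Num.truncn (1 - h)^-1.
have hkh : h <= hk k.
  rewrite /hk lerBrDr -lerBrDl -[leRHS]invrK lef_pV2 ?posrE ?invr_gt0 //.
  apply: le_trans (ltW (truncnS_gt _)) _; by rewrite ler_nat.
apply: recurrent_sub (window_centered _ _ _ (H k L)) => a Ha y ya.
exact: le_trans hkh (Ha y ya).
Qed.

Lemma ae_has_valleys :
  (forall h (l : nat), 0 < h < 1 -> (0 < l)%N ->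
     (0 < P [set w | forall y : nat, (y <= l)%N -> (V (Tpow T Ti y%:Z w) <= h)%R])%E) ->
  {ae P, forall w, has_valleys (potential w)}.
Proof.
move=> hvalley; pose hk (k : nat) : R := k.+2%:R^-1.
have hk01 k : 0 < hk k < 1 by rewrite invf_lt1 ?invr_gt0 ?ltr1n ?ltr0n.
have mh k : measurable [set r : R | r <= hk k].
  rewrite (_ : [set r | _] = `]-oo, hk k]%classic); first exact: measurable_itv.
  by apply/seteqP; split => r /=; rewrite in_itv.
have H := ae_foralln (fun k => ae_foralln (fun L : nat =>
  ae_recurrent_window (fun r => r <= hk k) L.*2.+1 (mh k) (hvalley _ _ (hk01 k) (ltn0Sn L.*2)))).
apply: filterS H => w H h L h0.
pose k := Num.truncn h^-1.
have hkh : hk k <= h.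
  rewrite /hk -[leRHS]invrK lef_pV2 ?posrE ?invr_gt0 //.
  apply: le_trans (ltW (truncnS_gt _)) _; by rewrite ler_nat.
apply: recurrent_sub (window_centered (fun r => r <= hk k) L w (H k L)) => a Ha y ya.
exact: le_trans (Ha y ya) hkh.
Qed.

Lemma exists_rate_function : exists gam : R -> R -> R, forall beta lam, 0 <= beta < lam ->
  {ae P, forall w, good_potential (potential w) beta lam (gam beta lam)}.
Proof.
have /choice[gam Hgam] (bl : R * R) : exists g, 0 <= bl.1 < bl.2 ->
    {ae P, forall w, good_potential (potential w) bl.1 bl.2 g}.
  have [/ae_good_potential[g Hg]|n] := boolP (0 <= bl.1 < bl.2); last by exists 0.
  by exists g.
by exists (fun b l => gam (b, l)) => b l; exact: (Hgam (b, l)).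
Qed.

Lemma free_energy_unique beta theta l :
  {ae P, forall w, n%:R^-1 * ln (path_expect (n := n) srw 0
     (exp_cost T Ti V beta theta n w)) @[n --> \oo] --> l} ->
  tilted_free_energy P T Ti V beta theta = l.
Proof.
move=> Hl; rewrite /tilted_free_energy; set S := [set _ | _].
have Sg : S (get S) by apply: getPex; exists l.
have [w [Hw1 Hw2]] : exists w, (n%:R^-1 * ln (path_expect (n := n) srw 0
     (exp_cost T Ti V beta theta n w)) @[n --> \oo] --> get S) /\
   (n%:R^-1 * ln (path_expect (n := n) srw 0
     (exp_cost T Ti V beta theta n w)) @[n --> \oo] --> l).
  by apply: (ae_ex P); apply: filterS2 Sg Hl => w; split.
exact: cvg_unique Hw1 Hw2.
Qed.

Lemma free_energy_growth beta theta mu :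
  {ae P, forall w, lower_growth (potential w) beta 0 mu theta /\
                   upper_growth (potential w) beta 0 mu theta} ->
  tilted_free_energy P T Ti V beta theta = mu.
Proof.
move=> H; apply: free_energy_unique; apply: filterS H => w [Hl Hu].
exact: free_energy_cvg.
Qed.

Section rate_function.
Variable gam : R -> R -> R.
Hypothesis gamP : forall beta lam, 0 <= beta < lam ->
  {ae P, forall w, good_potential (potential w) beta lam (gam beta lam)}.

Lemma rate_ge beta lam : 0 <= beta < lam -> lam - beta <= gam beta lam.
Proof.
move=> bl; have [w [[f Df] _]] := ae_ex P _ (gamP _ _ bl).
exact: decaying_solution_rate_ge Df.
Qed.

Lemma rate_monotone beta lam1 lam2 : 0 <= beta < lam1 -> lam1 <= lam2 ->
  gam beta lam1 <= gam beta lam2.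
Proof.
move=> bl1 l12; have /andP[b0 b1] := bl1.
have bl2 : 0 <= beta < lam2 by rewrite b0 (lt_le_trans b1).
have [w [[[f1 D1] _] [[f2 D2] _]]] := ae_ex P (fun w => _ /\ _)
  (filterI (gamP _ _ bl1) (gamP _ _ bl2)).
apply: (decaying_solution_monotone _ _ _ _ _ _ _ _ _ D1 D2) => //.
  by have /andP[] := bl2.
by move=> y; rewrite lerD2r.
Qed.

Lemma rate_lipschitz beta1 lam1 beta2 lam2 (m M : R) : 0 < m ->
  0 <= beta1 <= lam1 - m -> 0 <= beta2 <= lam2 - m -> lam1 <= M ->
  gam beta1 lam1 - gam beta2 lam2
  <= 4 * expR M ^+ 2 / (1 - expR (- m)) * (`|lam1 - lam2| + `|beta1 - beta2|).
Proof.
move=> m0 /andP[b10 b1] /andP[b20 b2] lM.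
have bl1 : 0 <= beta1 < lam1 by rewrite b10 (le_lt_trans b1) // gtrBl.
have bl2 : 0 <= beta2 < lam2 by rewrite b20 (le_lt_trans b2) // gtrBl.
have [w [[[f1 D1] _] [[f2 D2] _]]] := ae_ex P (fun w => _ /\ _)
  (filterI (gamP _ _ bl1) (gamP _ _ bl2)).
apply: (decaying_solution_lipschitz _ _ _ _ _ _ _ _ _ m M _ D1 D2) => //.
- move=> y; apply: le_trans lM; rewrite gerBl mulr_ge0 //.
  by have /andP[] := V01 (Tpow T Ti y w).
- move=> y; have /andP[v0 v1] : 0 <= potential w y <= 1 := V01 _.
  move: v0 v1; move: (potential w y) => v v0 v1.
  have : `|(beta1 - beta2) * v| <= `|beta1 - beta2| by rewrite normrM (ger0_norm v0) ler_piMr.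
  have := ler_norm (lam1 - lam2); have := ler_norm (- ((beta1 - beta2) * v)).
  by rewrite normrN; lra.
Qed.

End rate_function.

End random_environment.

(** The bound holds on [[a, b]] only; composing [f] with the projection [cl] onto [[a, b]] makes it
    continuous on the whole line. *)
Lemma lipschitz_ivt (R : realType) (f : R -> R) (a b K v : R) : a <= b -> 0 <= K ->
  (forall x y, a <= x <= b -> a <= y <= b -> f x - f y <= K * `|x - y|) ->
  Num.min (f a) (f b) <= v <= Num.max (f a) (f b) ->
  exists2 x, a <= x <= b & f x = v.
Proof.
move=> ab K0 Hf Hv; pose cl (x : R) : R := Num.max a (Num.min b x).
have clab x : a <= cl x <= b by rewrite le_max lexx /= ge_max ab ge_min lexx.
have cla : cl a = a by rewrite /cl min_r // max_l.
have clb : cl b = b by rewrite /cl minxx max_r.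
have cl_lip x y : `|cl x - cl y| <= `|x - y|.
  have cl1 u z : u - z <= `|u - z| /\ 0 <= `|u - z| :> R by rewrite ler_norm normr_ge0.
  have [H1 H2] := cl1 x y; have [H3 _] := cl1 y x; rewrite distrC in H3.
  have clE z : [\/ z <= a /\ cl z = a, a <= z <= b /\ cl z = z | b <= z /\ cl z = b].
    rewrite /cl; have [bz|zb] := leP b z; first by apply: Or33; rewrite max_r.
    have [az|za] := leP a z; first by apply: Or32; rewrite (ltW zb).
    by apply: Or31; rewrite ltW.
  by rewrite ler_norml; case: (clE x) => -[hx ->]; case: (clE y) => -[hy ->]; lra.
have cont : continuous (f \o cl).
  move=> x; apply/cvgrPdist_le => e e0.
  have d0 : 0 < e / (K + 1) by rewrite divr_gt0 //; lra.
  have /cvgrPdist_le /(_ _ d0) := @cvg_id _ (nbhs x).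
  apply: filterS => y xy; have Kxy : K * `|cl x - cl y| <= e.
    apply: (@le_trans _ _ (K * (e / (K + 1)))).
      by rewrite ler_wpM2l // (le_trans (cl_lip _ _)).
    rewrite mulrCA -[leRHS]mulr1 ler_wpM2l ?(ltW e0) // ler_pdivrMr; lra.
  have := Hf _ _ (clab x) (clab y); have := Hf _ _ (clab y) (clab x).
  rewrite distrC /= ler_norml; lra.
have [|x xab fx] := IVT ab (continuous_subspaceT cont) (v := v); first by rewrite /= cla clb.
by exists (cl x).
Qed.

(** * The effective Hamiltonian *)

Section effective_hamiltonian.
Context {d : measure_display} {Omega : measurableType d} {R : realType}.
Variables (P : probability Omega R) (T Ti : Omega -> Omega) (V : Omega -> R).
Hypotheses (hT : invertible_mpt P T Ti) (erg : ergodic P T).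
Hypotheses (mV : measurable_fun setT V) (V01 : forall w, 0 <= V w <= 1).
Hypothesis hhill : forall (h : R) (l : nat), 0 < h < 1 -> (0 < l)%N ->
  (0 < P [set w | forall y : nat, (y <= l)%N -> (h <= V (Tpow T Ti y%:Z w))%R])%E.
Variable gam : R -> R -> R.
Hypothesis gamP : forall beta lam : R, 0 <= beta < lam ->
  {ae P, forall w, good_potential (env T Ti V w) beta lam (gam beta lam)}.
Implicit Types (beta lam c theta delta mu : R) (w : Omega).

Notation potential := (env T Ti V).

Lemma cosh0 : cosh 0 = 1 :> R.
Proof. by rewrite /cosh oppr0 expR0; field. Qed.

(** Tilting by [c] leaves the tilt [|theta| - c] for simple random walk. Its sign decides whether
    the growing or the decaying solution gives the lower bound, and only the latter restricts
    [lam]. *)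
Lemma ae_growth beta delta c lam theta :
  0 <= beta < lam -> 0 <= delta <= 1 -> 0 <= c -> tilt delta c ->
  gam beta lam = `| `|theta| - c| -> (`|theta| < c -> lam <= ln (cosh c)) ->
  {ae P, forall w,
    lower_growth (potential w) beta delta (lam - ln (cosh c)) theta /\
    upper_growth (potential w) beta delta (lam - ln (cosh c)) theta}.
Proof.
move=> bl d01 c0 tc gE lc; have /andP[b0 b1] := bl.
apply: filterS (gamP _ _ bl) => w Hw.
apply: (growth_abs (fun X => good_potential X beta lam (gam beta lam) /\
  forall y, 0 <= X y <= 1)); [|move=> X [gX X01]|by split => // y; exact: V01].
  by move=> X [gX X01]; split; [exact: good_potential_opp | move=> y; exact: X01].
have X0 y : 0 <= X y by have /andP[] := X01 y.
split; last first.
  by apply: upper_growth_tilt => //; apply: upper_growth_free gX _; rewrite gE.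
have [ct|tc'] := leP c `|theta|.
  rewrite (_ : `|theta| = c + gam beta lam).
    exact: lower_growth_right gX.
  have ct' : 0 <= `|theta| - c by rewrite subr_ge0.
  by rewrite gE (ger0_norm ct'); ring.
rewrite (_ : `|theta| = c - gam beta lam).
  apply: (lower_growth_left X beta) => //; last exact: lc.
    exact: le_lt_trans tc'.
  by rewrite b0 lexx.
have ct' : `|theta| - c < 0 by rewrite subr_lt0.
by rewrite gE (ltr0_norm ct'); ring.
Qed.

(** Hills give the lower bound; the upper bound holds with [lam - ln (cosh c)] for every
    [lam > beta], and [lam] decreases to [beta]. *)
Lemma ae_growth_flat beta delta c theta : {ae P, forall w, has_hills (potential w)} ->
  0 <= beta -> 0 <= delta < 1 -> 0 <= c -> tilt delta c ->
  (forall lam, beta < lam -> `| `|theta| - c| <= gam beta lam) ->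
  {ae P, forall w,
    lower_growth (potential w) beta delta (beta - ln (cosh c)) theta /\
    upper_growth (potential w) beta delta (beta - ln (cosh c)) theta}.
Proof.
move=> hills b0 d01 c0 tc gE; have /andP[d0 d1] := d01.
pose lam (k : nat) := beta + k.+1%:R^-1.
have bl k : 0 <= beta < lam k by rewrite b0 ltrDl invr_gt0 ltr0n.
apply: filterS2 hills (ae_foralln (fun k => gamP _ _ (bl k))) => w hillw Hw.
apply: (growth_abs (fun X => [/\ forall k, good_potential X beta (lam k) (gam beta (lam k)),
  has_hills X & forall y, 0 <= X y <= 1])); [|move=> X [gX hX X01]|by split => // y; exact: V01].
  move=> X [gX hX X01]; split; [|exact: has_hills_opp|by move=> y; exact: X01].
  by move=> k; exact: good_potential_opp.
have X0 y : 0 <= X y by have /andP[] := X01 y.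
split; first exact: lower_growth_hills.
apply: upper_growth_tilt => //; first by rewrite d0 ltW.
apply: upper_growth_limit => e e0; pose k := Num.truncn e^-1.
have ke : k.+1%:R^-1 <= e.
  by rewrite -[leRHS]invrK lef_pV2 ?posrE ?invr_gt0 // ltW // truncnS_gt.
apply: (@upper_growth_le _ _ _ _ (lam k)); first by rewrite lerD2l.
by apply: upper_growth_free (gX k) _; apply: gE; have /andP[] := bl k.
Qed.

(** By [rate_ge] and the Lipschitz bound, [gam beta] is unbounded and continuous, so it attains
    everything above any of its values. *)
Lemma rate_dichotomy beta r : 0 <= beta ->
  (exists2 lam, beta < lam & gam beta lam = r) \/
  (forall lam, beta < lam -> r <= gam beta lam).
Proof.
move=> b0; have [[lam1 [bl1 g1]]|n] := pselect (exists lam, beta < lam /\ gam beta lam < r);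
  last first.
  right=> lam bl; rewrite leNgt; apply/negP => H.
  by apply: n; exists lam.
left; pose lam2 := Num.max lam1 (beta + r).
have l12 : lam1 <= lam2 by rewrite le_max lexx.
have g2 : r <= gam beta lam2.
  have bl2 : 0 <= beta < lam2 by rewrite b0 (lt_le_trans bl1).
  apply: le_trans (rate_ge P T Ti V gam gamP _ _ bl2).
  by rewrite lerBrDl le_max lexx orbT.
pose m := lam1 - beta; have m0 : 0 < m by rewrite subr_gt0.
have [|||lam /andP[l1 _] E] := lipschitz_ivt R (gam beta) lam1 lam2
  (4 * expR lam2 ^+ 2 / (1 - expR (- m))) r l12.
- by rewrite divr_ge0 ?mulr_ge0 ?exprn_ge0 ?expR_ge0 // subr_ge0 ltW // expR_lt1 oppr_lt0.
- move=> x y /andP[x1 x2] /andP[y1 y2].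
  have := rate_lipschitz P T Ti V V01 gam gamP beta x beta y m lam2 m0.
  rewrite subrr normr0 addr0; apply; rewrite ?b0 //= /m; lra.
- by rewrite ge_min (ltW g1) /= le_max g2 orbT.
by exists lam => //; exact: lt_le_trans l1.
Qed.

(** * The regime [beta < ln (cosh c)] *)

Section weak_control.
Variables (delta c beta : R).
Hypotheses (d01 : 0 <= delta < 1) (c0 : 0 < c) (tc : tilt delta c).
Hypotheses (b0 : 0 < beta) (bl : beta < ln (cosh c)).
Hypotheses (hills : {ae P, forall w, has_hills (potential w)})
  (valleys : {ae P, forall w, has_valleys (potential w)}).

Let bl' : 0 <= beta < ln (cosh c). Proof. by rewrite ltW. Qed.

Lemma free_energyE theta lam : beta < lam -> gam beta lam = `|theta| ->
  tilted_free_energy P T Ti V beta theta = lam.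
Proof.
move=> blam gE; apply: free_energy_growth.
have := ae_growth beta 0 0 lam theta; rewrite cosh0 ln1 !subr0; apply.
- by rewrite ltW.
- by rewrite lexx ler01.
- by [].
- exact: tilt0.
- by rewrite normr_id.
- by rewrite ltNge normr_ge0.
Qed.

Lemma free_energy_flat theta : (forall lam, beta < lam -> `|theta| <= gam beta lam) ->
  tilted_free_energy P T Ti V beta theta = beta.
Proof.
move=> gE; apply: free_energy_growth.
have := ae_growth_flat beta 0 0 theta hills; rewrite cosh0 ln1 !subr0; apply.
- exact: ltW.
- by rewrite lexx ltr01.
- by [].
- exact: tilt0.
- by move=> lam bllam; rewrite normr_id; exact: gE.
Qed.

Lemma rate_free : gam 0 (ln (cosh c)) = c.
Proof.
have l0 : 0 < ln (cosh c) by exact: lt_trans bl.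
have H : 0 <= (0 : R) < ln (cosh c) by rewrite lexx.
have [w [[f Df] _]] := ae_ex P _ (gamP _ _ H).
exact: decaying_solution_free_rate c0 l0 Df.
Qed.

Lemma rate_lt : gam beta (ln (cosh c)) < c.
Proof.
have mge := measurable_ge (2^-1 : R).
have mQ : measurable [set w | 2^-1 <= V w].
  by rewrite -[X in measurable X]setTI; exact: (mV measurableT _ mge).
have PQ : (0 < P [set w | (2^-1 <= V w)%R])%E.
  have h01 : 0 < (2^-1 : R) < 1 by apply/andP; split; lra.
  apply: lt_le_trans (hhill _ 1%N h01 isT) _; apply: le_measure; rewrite ?inE //.
    exact: (measurable_window P T Ti V hT mV (fun r => 2^-1 <= r) 1 mge).
  by move=> w /= /(_ 0%N isT).
have [w [[[f Df] _] [F [p [p0 sF FE]]]]] := ae_ex P (fun w => _ /\ _)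
  (filterI (gamP _ _ bl') (ae_recurrent P T Ti hT erg _ mQ PQ)).
exact: (decaying_solution_strict _ _ _ _ _ f (fun y => V01 _) c0 (ltW b0) bl Df F p).
Qed.

Definition thetabar := c - gam beta (ln (cosh c)).

Lemma thetabar_gt0 : 0 < thetabar.
Proof. by rewrite subr_gt0 rate_lt. Qed.

Lemma thetabar_lt : thetabar < c.
Proof.
rewrite gtrBl; apply: lt_le_trans (rate_ge P T Ti V gam gamP _ _ bl').
by rewrite subr_gt0.
Qed.

Lemma thetabar_unique : unique (fun s => 0 < s < c /\
  tilted_free_energy P T Ti V beta (s - c) = ln (cosh c)) thetabar.
Proof.
split=> [|s [/andP[s0 sc] E]].
  rewrite thetabar_gt0 thetabar_lt; split => //; apply: free_energyE => //.
  rewrite /thetabar addrAC subrr sub0r normrN ger0_norm //.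
  by have := thetabar_lt; rewrite gtrBl; exact: ltW.
(* If no rate were below [|s - c|] the free energy would be [beta], which is less than
   [ln (cosh c)]; otherwise the free energy determines the rate and hence [s]. *)
have [[lam blam gE]|flat] := rate_dichotomy beta `|s - c| (ltW b0); last first.
  by move: bl; rewrite -E free_energy_flat // ltxx.
have lE := free_energyE _ _ blam gE; rewrite E in lE.
have sc0 : s - c < 0 by rewrite subr_lt0.
by move: gE; rewrite -lE (ltr0_norm sc0) /thetabar => ->; ring.
Qed.

(* The lower bound comes from a smaller potential b1 V, with b1 chosen by the intermediate
   value theorem so that its critical tilt is exactly theta. *)
Lemma ae_growth_trapped theta : `|theta| < thetabar ->
  {ae P, forall w, lower_growth (potential w) beta delta 0 theta /\
                   upper_growth (potential w) beta delta 0 theta}.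
Proof.
move=> tt; have /andP[d0 d1] := d01; have l0 : 0 < ln (cosh c) by exact: lt_trans bl.
pose m := ln (cosh c) - beta; have m0 : 0 < m by rewrite subr_gt0.
have [|||b1 /andP[b10 b11] E] := lipschitz_ivt R (gam ^~ (ln (cosh c))) 0 beta
  (4 * expR (ln (cosh c)) ^+ 2 / (1 - expR (- m))) (c - `|theta|) (ltW b0).
- by rewrite divr_ge0 ?mulr_ge0 ?exprn_ge0 ?expR_ge0 // subr_ge0 ltW // expR_lt1 oppr_lt0.
- move=> x y /andP[x1 x2] /andP[y1 y2].
  have := rate_lipschitz P T Ti V V01 gam gamP x (ln (cosh c)) y (ln (cosh c)) m _ m0.
  by rewrite subrr normr0 add0r /m subKr x1 y1 x2 y2; apply.
(* The rate is [c] at [b1 = 0] and [c - thetabar] at [b1 = beta]; the target [c - |theta|] lies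
   between them. *)
- rewrite rate_free ge_min le_max; have := normr_ge0 theta.
  by move: tt; rewrite /thetabar => ? ?; apply/andP; split; apply/orP; [right|left]; lra.
have bl1 : 0 <= b1 < ln (cosh c) by rewrite b10 (le_lt_trans b11).
apply: filterS3 (gamP _ _ bl') (gamP _ _ bl1) valleys => w gw g1w vw.
apply: (growth_abs (fun X => [/\ good_potential X beta (ln (cosh c)) (gam beta (ln (cosh c))),
  good_potential X b1 (ln (cosh c)) (c - `|theta|), has_valleys X & forall y, 0 <= X y <= 1])).
- move=> X [gX g1X vX X01]; split; [exact: good_potential_opp|exact: good_potential_opp|
    exact: has_valleys_opp|by move=> y; exact: X01].
- move=> X [gX g1X vX X01]; have X0 y : 0 <= X y by have /andP[] := X01 y.
  have d01' : 0 <= delta <= 1 by rewrite d0 ltW.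
  split; last first.
    apply: (upper_growth_valleys X beta delta c _ _ X0 bl' d01' c0 tc gX vX).
    by rewrite normr_id; exact: ltW tt.
  have := lower_growth_left X b1 beta delta _ c _ X01 d01' tc c0 _ _ (lexx _) g1X.
  rewrite subrr subKr b10 b11; apply=> //.
  by have /andP[] := bl1.
- by rewrite -E; split => // y; exact: V01.
Qed.

Definition effective_hamiltonian theta : R :=
  if `|theta| < `|thetabar| then 0
  else tilted_free_energy P T Ti V beta (`|theta| - c) - ln (cosh c).

Lemma ae_growth_effective theta :
  {ae P, forall w, lower_growth (potential w) beta delta (effective_hamiltonian theta) theta /\
                   upper_growth (potential w) beta delta (effective_hamiltonian theta) theta}.
Proof.
have /andP[d0 d1] := d01; have d01' : 0 <= delta <= 1 by rewrite d0 ltW.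
rewrite /effective_hamiltonian (gtr0_norm thetabar_gt0).
have [tt|tt] := ltP; first exact: ae_growth_trapped.
have [[lam blam gE]|flat] := rate_dichotomy beta `| `|theta| - c| (ltW b0); last first.
  by rewrite free_energy_flat //; apply: ae_growth_flat => //; exact: ltW.
rewrite (free_energyE _ _ blam gE); apply: ae_growth => //; first by rewrite ltW.
  exact: ltW.
(* If [lam] exceeded [ln (cosh c)], monotonicity would squeeze [gam beta] to the same value at both
   points, and both would be the free energy at [|theta| - c]. *)
move=> tc'; rewrite leNgt; apply/negP => llam.
have gE' : gam beta (ln (cosh c)) = `| `|theta| - c|.
  apply/le_anti; rewrite -{1}gE (rate_monotone P T Ti V gam gamP _ _ _ bl' (ltW llam)) /=.
  rewrite ltr0_norm ?subr_lt0 //; move: tt; rewrite /thetabar; lra.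
have := free_energyE _ _ bl gE'; rewrite (free_energyE _ _ blam gE) => E.
by move: llam; rewrite E ltxx.
Qed.

End weak_control.

End effective_hamiltonian.

Lemma tilt_ln (R : realType) (delta : R) : 0 < delta < 1 ->
  0 < 2^-1 * ln ((1 + delta) / (1 - delta)) /\
  tilt delta (2^-1 * ln ((1 + delta) / (1 - delta))).
Proof.
move=> /andP[d0 d1]; have d10 : 0 < 1 - delta by lra.
have q0 : 0 < (1 + delta) / (1 - delta) by rewrite divr_gt0 //; lra.
set c := 2^-1 * _.
have e2 : expR c * expR c * (1 - delta) = 1 + delta.
  by rewrite -expRD /c (_ : forall r : R, 2^-1 * r + 2^-1 * r
    = r) ?lnK ?posrE // ?divfK ?gt_eqF // => r; field.
have ec := expR_gt0 c; split.
  by rewrite mulr_gt0 // ln_gt0 // ltr_pdivlMr //; lra.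
rewrite /tilt /cosh expRN; split.
  have -> : (1 + delta) * ((expR c + (expR c)^-1) / 2)
    = ((1 + delta) * (expR c * expR c) + (1 + delta)) / 2 / expR c by field; rewrite gt_eqF.
  rewrite -{2}e2; by field; rewrite gt_eqF.
have -> : (1 - delta) * ((expR c + (expR c)^-1) / 2)
    = (expR c * expR c * (1 - delta) + (1 - delta)) / 2 / expR c by field; rewrite gt_eqF.
by rewrite e2; field; rewrite gt_eqF.
Qed.

Theorem theorem2p3 (d : measure_display) (Omega : measurableType d)
    (R : realType) (P : probability Omega R) (T Ti : Omega -> Omega)
    (hT : invertible_mpt P T Ti) (hergodic : ergodic P T)
    (V : Omega -> R) (hVmeas : measurable_fun setT V)
    (hV01 : forall w, 0 <= V w <= 1)
    (hVnonconst : exists w w', V w <> V w')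
    (hinf : ess_inf P (EFin \o V) = 0%E)
    (hsup : ess_sup P (EFin \o V) = 1%E)
    (hvalley : forall (h : R) (l : nat), 0 < h < 1 -> (0 < l)%N ->
       (0 < P [set w | forall y : nat, (y <= l)%N ->
                         (V (Tpow T Ti y%:Z w) <= h)%R])%E)
    (hhill : forall (h : R) (l : nat), 0 < h < 1 -> (0 < l)%N ->
       (0 < P [set w | forall y : nat, (y <= l)%N ->
                         (h <= V (Tpow T Ti y%:Z w))%R])%E)
    (delta : R) (hdelta : 0 < delta < 1)
    (c : R) (hc : c = 2^-1 * ln ((1 + delta) / (1 - delta)))
    (beta : R) (hbeta : 0 < beta < ln (cosh c)) (theta : R) :
  {ae P, forall w, forall t x : R, 0 < t ->
     cvg (scaled_u T Ti V delta beta theta w t x eps @[eps --> 0^'+])} /\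
  exists Hbar : R,
    [/\ {ae P, forall w, u_o T Ti V delta beta theta w 1 0 = Hbar},
        {ae P, forall w, forall t x : R, 0 < t ->
           u_o T Ti V delta beta theta w t x = t * Hbar + theta * x}
      & exists thetabar : R,
          unique (fun s : R => 0 < s < c /\
            tilted_free_energy P T Ti V beta (s - c) = ln (cosh c)) thetabar /\
          Hbar = if `|theta| < `|thetabar| then 0
                 else tilted_free_energy P T Ti V beta (`|theta| - c)
                      - ln (cosh c)].
Proof.
have [c0 tc] := tilt_ln R delta hdelta; rewrite -hc in c0 tc.
have [gam gamP] := exists_rate_function P T Ti V hT hergodic hVmeas hV01.
have hills := ae_has_hills P T Ti V hT hergodic hVmeas hhill.
have valleys := ae_has_valleys P T Ti V hT hergodic hVmeas hvalley.
have /andP[d0 d1] := hdelta; have /andP[b0 bl] := hbeta.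
have d01 : 0 <= delta < 1 by rewrite ltW.
have d01' : 0 <= delta <= 1 by rewrite !ltW.
pose H := effective_hamiltonian P T Ti V gam c beta theta.
have growth : {ae P, forall w,
    lower_growth (env T Ti V w) beta delta H theta /\
    upper_growth (env T Ti V w) beta delta H theta}.
  exact: ae_growth_effective.
split.
  apply: filterS growth => w [low up] t x t0.
  by apply/cvg_ex; eexists; exact: scaled_u_cvg low up t0.
exists H; split.
- apply: filterS growth => w [low up].
  by rewrite (u_o_eq _ _ _ _ _ _ _ _ _ _ d01' low up) // mul1r mulr0 addr0.
- by apply: filterS growth => w [low up] t x t0; exact: u_o_eq low up t0.
exists (thetabar gam c beta); split; first exact: thetabar_unique.
by [].
Qed.
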